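(* Let $f_i:\mathbb{R}^{n_i}\to[0,\infty)$ ($1\le i\le N$) and $g_j:\mathbb{R}^{m_j}\to[0,\infty)$ ($1\le j\le M$) be smooth, let $U=(u_{i,j})$ be a real $N\times M$ matrix, and assume that the zero-sum bilinear game with payoff matrix $U$ has a fully mixed Nash equilibrium $(p,q)$. Consider the system $$\dot{\theta}_i=-\nabla f_i(\theta_i)\Big(\sum_{j=1}^M u_{i,j}g_j(\phi_j)+\lambda\Big),\qquad \dot{\phi}_j=\nabla g_j(\phi_j)\Big(\sum_{i=1}^N u_{i,j}f_i(\theta_i)+\mu\Big),$$ $$\dot{\mu}=-\Big(\sum_{j=1}^M g_j(\phi_j)-1\Big),\qquad \dot{\lambda}=\sum_{i=1}^N f_i(\theta_i)-1 .$$ Assume that $(\theta(0),\phi(0),\lambda(0),\mu(0))$ is a safe initialization. Then the trajectory of this system starting at $(\theta(0),\phi(0),\lambda(0),\mu(0))$ is diffeomorphic to a trajectory of a Poincar\'e recurrent flow.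
   Context: Here $\theta=(\theta_1,\dots,\theta_N)$, $\phi=(\phi_1,\dots,\phi_M)$ with $\theta_i\in\mathbb{R}^{n_i}$, $\phi_j\in\mathbb{R}^{m_j}$, and $\lambda,\mu\in\mathbb{R}$ are Lagrange multipliers. The system is continuous-time gradient-descent-ascent for $\min_{\theta,\mu}\max_{\phi,\lambda}\ F(\theta)^\top U G(\phi)+\lambda(\sum_i f_i(\theta_i)-1)+\mu(\sum_j g_j(\phi_j)-1)$ with $F=(f_i)_i$, $G=(g_j)_j$. A fully mixed Nash equilibrium $(p,q)$ of the game $U$ is a pair of probability vectors $p\in\mathbb{R}^N$, $q\in\mathbb{R}^M$ with all entries strictly positive such that $p$ minimizes $x\mapsto x^\top Uq$ over probability vectors $x$ and $q$ maximizes $y\mapsto p^\top Uy$ over probability vectors $y$. The gradient ascent flows of all $f_i$ and $g_j$ are assumed to be defined for all times. For each $i$, let $\gamma_i:\mathbb{R}\to\mathbb{R}^{n_i}$ solve $\dot\gamma_i=\nabla f_i(\gamma_i)$, $\gamma_i(0)=\theta_i(0)$, and define $f_{i,\theta_i(0)}=\{f_i(\gamma_i(s)):s\in\mathbb{R}\}$; $g_{j,\phi_j(0)}$ is defined in the same way from $g_j$ and $\phi_j(0)$. The initialization is called safe if, for all $i,j$, $\theta_i(0)$ is not a stationary point of $f_i$, $\phi_j(0)$ is not a stationary point of $g_j$, $p_i\in f_{i,\theta_i(0)}$ and $q_j\in g_{j,\phi_j(0)}$. Recurrence: for a flow $\Psi$, a point $x$ is recurrent if for every neighborhood $W$ of $x$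 there is an increasing sequence of times $t_k\to\infty$ with $\Psi(x,t_k)\in W$ for all $k$. A flow $\Psi$ on a set $B\subseteq\mathbb{R}^k$ of non-zero Lebesgue measure is Poincar\'e recurrent if the set of non-recurrent points of $B$ has Lebesgue measure zero. Two flows $\Phi_t:A\to A$ and $\Psi_t:B\to B$ are diffeomorphic if there is a diffeomorphism $\nu:A\to B$ with $\nu(\Phi_t(x))=\Psi_t(\nu(x))$ for all $x\in A$, $t\in\mathbb{R}$. The trajectory of a point $x_0$ under a flow $\Phi$ being diffeomorphic to a trajectory of a Poincar\'e recurrent flow means: there are a $\Phi$-invariant smooth submanifold $A$ containing $x_0$, an open set $B$ of some $\mathbb{R}^k$, a Poincar\'e recurrent flow $\Psi$ on $B$, and a diffeomorphism $\nu:A\to B$ with $\nu(\Phi_t(x))=\Psi_t(\nu(x))$ for all $x\in A$, $t\in\mathbb{R}$ (so the trajectory of $x_0$ is carried to that of $\nu(x_0)$). *)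

(* Defs.v *)
From mathcomp Require Import all_boot all_order all_algebra.
From mathcomp Require Import all_classical all_reals all_analysis.
Import Order.TTheory GRing.Theory Num.Theory.
Import numFieldNormedType.Exports.
Set Implicit Arguments.
Unset Strict Implicit.
Unset Printing Implicit Defensive.
Local Open Scope classical_set_scope.
Local Open Scope ring_scope.

(* [Ck_on k O f]: f is of class C^k on the open set O (openness of O is required
   by the users of this predicate). V is finite-dimensional wherever it is used,
   so quantifying over all directions v amounts to quantifying over partials. *)
Fixpoint Ck_on (R : realType) (V W : normedModType R) (k : nat) (O : set V)
    (f : V -> W) : Prop :=
  if k is k'.+1 then
    (forall x, O x -> differentiable f x) /\
    (forall v, Ck_on k' O (fun x => 'D_v f x))
  else forall x, O x -> {for x, continuous f}.

Definition smooth (R : realType) (V W : normedModType R) (f : V -> W) : Prop :=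
  forall k, Ck_on k setT f.

(* Smoothness on an arbitrary subset A: near each point of A, f is the
   restriction of a map that is C^oo on a neighbourhood in the ambient space.
   For open A this is the usual C^oo. *)
Definition smooth_on (R : realType) (V W : normedModType R) (A : set V)
    (f : V -> W) : Prop :=
  forall x, A x -> exists (O : set V) (h : V -> W),
    [/\ open_nbhs x O, forall k, Ck_on k O h & {in A `&` O, f =1 h}].

Definition diffeomorphism (R : realType) (V W : normedModType R)
    (A : set V) (B : set W) (nu : V -> W) : Prop :=
  smooth_on A nu /\ set_fun A B nu /\
  exists nu' : W -> V,
    [/\ smooth_on B nu', set_fun B A nu',
        {in A, cancel nu nu'} & {in B, cancel nu' nu}].

Definition smooth_submanifold (R : realType) (V : normedModType R) (d : nat)
    (A : set V) : Prop :=
  forall x, A x -> exists (O : set V) (C : set 'rV[R]_d) (chart : V -> 'rV[R]_d),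
    [/\ open_nbhs x O, open C & diffeomorphism (A `&` O) C chart].

Definition grad (R : realType) (n : nat) (f : 'rV[R]_n -> R) (x : 'rV[R]_n) :
    'rV[R]_n :=
  \row_i 'D_(delta_mx 0 i) f x.

Definition integral_curve (R : realType) (V : normedModType R) (F : V -> V)
    (x : V) (c : R -> V) : Prop :=
  c 0 = x /\ forall t : R, is_derive t 1 c (F (c t)).

Definition is_flow (R : realType) (T : topologicalType) (A : set T)
    (Phi : R -> T -> T) : Prop :=
  [/\ forall t, set_fun A A (Phi t),
      forall x, A x -> Phi 0 x = x,
      forall s t x, A x -> Phi (s + t) x = Phi s (Phi t x)
    & {within [set: R] `*` A, continuous (fun tx => Phi tx.1 tx.2)}].

(* The vector field F may have incomplete solutions outside A. *)
Definition is_flow_of (R : realType) (V : normedModType R) (F : V -> V)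
    (A : set V) (Phi : R -> V -> V) : Prop :=
  is_flow A Phi /\ forall x, A x -> integral_curve F x (fun t => Phi t x).

Definition box (R : realType) (k : nat) (a b : 'rV[R]_k) : set 'rV[R]_k :=
  [set x | forall i, a 0 i <= x 0 i <= b 0 i].

Definition box_volume (R : realType) (k : nat) (a b : 'rV[R]_k) : R :=
  \prod_(i < k) Num.max 0 (b 0 i - a 0 i).

(* k-dimensional Lebesgue outer measure. The predicate P allows finite and empty
   families of boxes, which matters in dimension 0, where every box has volume 1. *)
Definition lebesgue_outer (R : realType) (k : nat) (E : set 'rV[R]_k) : \bar R :=
  ereal_inf [set s | exists (P : pred nat) (a b : nat -> 'rV[R]_k),
    E `<=` \bigcup_(n in [set n | P n]) box (a n) (b n) /\
    s = (\sum_(n <oo | P n) (box_volume (a n) (b n))%:E)%E].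

Definition recurrent (R : realType) (T : topologicalType) (Psi : R -> T -> T)
    (x : T) : Prop :=
  forall W : set T, nbhs x W -> exists t : nat -> R,
    [/\ increasing_seq t, t @ \oo --> +oo & forall k, W (Psi (t k) x)].

Definition poincare_recurrent (R : realType) (k : nat) (B : set 'rV[R]_k)
    (Psi : R -> 'rV[R]_k -> 'rV[R]_k) : Prop :=
  [/\ is_flow B Psi, lebesgue_outer B != 0%E
    & lebesgue_outer [set x | B x /\ ~ recurrent Psi x] = 0%E].

Definition conjugates (R : realType) (S T : Type) (A : set S)
    (Phi : R -> S -> S) (Psi : R -> T -> T) (nu : S -> T) : Prop :=
  forall x t, A x -> nu (Phi t x) = Psi t (nu x).

(* When F is locally Lipschitz (e.g. smooth), Phi is determined on A by F, so
   Phi _ x0 is the trajectory of F through x0; its global existence is part of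
   the assertion. The diffeomorphism nu carries it to the Psi-trajectory of
   nu x0. *)
Definition trajectory_diffeo_recurrent (R : realType) (V : normedModType R)
    (F : V -> V) (x0 : V) : Prop :=
  exists (k : nat) (A : set V) (Phi : R -> V -> V)
         (B : set 'rV[R]_k) (Psi : R -> 'rV[R]_k -> 'rV[R]_k)
         (nu : V -> 'rV[R]_k),
    [/\ smooth_submanifold k A /\ A x0,
        is_flow_of F A Phi,
        open B /\ poincare_recurrent B Psi,
        diffeomorphism A B nu
      & conjugates A Phi Psi nu].

Definition prob_vec (R : realType) (n : nat) (x : 'cV[R]_n) : Prop :=
  (forall i, 0 <= x i 0) /\ \sum_i x i 0 = 1.

Definition payoff (R : realType) (N M : nat) (U : 'M[R]_(N, M))
    (x : 'cV[R]_N) (y : 'cV[R]_M) : R :=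
  (x^T *m U *m y) 0 0.

(* The row player minimizes the payoff, the column player maximizes it. *)
Definition fully_mixed_nash (R : realType) (N M : nat) (U : 'M[R]_(N, M))
    (p : 'cV[R]_N) (q : 'cV[R]_M) : Prop :=
  [/\ prob_vec p /\ (forall i, 0 < p i 0),
      prob_vec q /\ (forall j, 0 < q j 0),
      forall x, prob_vec x -> payoff U p q <= payoff U x q
    & forall y, prob_vec y -> payoff U p y <= payoff U p q].

Definition complete_gradient_flow (R : realType) (n : nat)
    (f : 'rV[R]_n -> R) : Prop :=
  forall x, exists gamma, integral_curve (grad f) x gamma.

(* Values of f along its gradient ascent curve through x (unique for smooth f). *)
Definition ascent_values (R : realType) (n : nat) (f : 'rV[R]_n -> R)
    (x : 'rV[R]_n) : set R :=
  [set y | exists2 gamma, integral_curve (grad f) x gamma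
                        & exists s : R, y = f (gamma s)].

Definition safe_initialization (R : realType) (N M : nat)
    (n : 'I_N -> nat) (m : 'I_M -> nat)
    (f : forall i, 'rV[R]_(n i) -> R) (g : forall j, 'rV[R]_(m j) -> R)
    (p : 'cV[R]_N) (q : 'cV[R]_M)
    (theta0 : forall i, 'rV[R]_(n i)) (phi0 : forall j, 'rV[R]_(m j)) : Prop :=
  [/\ forall i, grad (f i) (theta0 i) != 0,
      forall j, grad (g j) (phi0 j) != 0,
      forall i, ascent_values (f i) (theta0 i) (p i 0)
    & forall j, ascent_values (g j) (phi0 j) (q j 0)].

(* Phase space of (theta, phi, lambda, mu); theta and phi are stored as the
   concatenations of their blocks theta_i and phi_j. *)
Definition state (R : realType) (N M : nat) (n : 'I_N -> nat)
    (m : 'I_M -> nat) : normedModType R :=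
  ('rV[R]_(\sum_i n i) * 'rV[R]_(\sum_j m j) * R * R)%type.

Definition mkstate (R : realType) (N M : nat) (n : 'I_N -> nat)
    (m : 'I_M -> nat) (theta : forall i, 'rV[R]_(n i))
    (phi : forall j, 'rV[R]_(m j)) (lambda mu : R) : state R n m :=
  (\mxrow_i theta i, \mxrow_j phi j, lambda, mu).

Definition gda_field (R : realType) (N M : nat) (n : 'I_N -> nat)
    (m : 'I_M -> nat) (f : forall i, 'rV[R]_(n i) -> R)
    (g : forall j, 'rV[R]_(m j) -> R) (U : 'M[R]_(N, M))
    (z : state R n m) : state R n m :=
  let: (thetas, phis, lambda, mu) := z in
  let theta i : 'rV[R]_(n i) := submxrow thetas i in
  let phi j : 'rV[R]_(m j) := submxrow phis j in
  mkstate
    (fun i => - ((\sum_j U i j * g j (phi j) + lambda) *: grad (f i) (theta i)))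
    (fun j => (\sum_i U i j * f i (theta i) + mu) *: grad (g j) (phi j))
    (\sum_i f i (theta i) - 1)
    (- (\sum_j g j (phi j) - 1)).

(* Main.v *)
From HB Require Import structures.
Require Import Defs.
From mathcomp Require Import finmap all_boot all_order all_algebra.
From mathcomp Require Import all_classical all_reals all_analysis.
From mathcomp Require Import zify ring lra.
Import Order.TTheory GRing.Theory Num.Theory.
Import numFieldNormedType.Exports.
Set Implicit Arguments.
Unset Strict Implicit.
Unset Printing Implicit Defensive.
Local Open Scope classical_set_scope.
Local Open Scope ring_scope.

(** Write gamma_i and delta_j for the gradient ascent curves through theta_i(0)
    and phi_j(0), F_i = f_i o gamma_i and G_j = g_j o delta_j. Each block theta_i
    moves by a scalar multiple of grad f_i, hence stays on the curve gamma_i, and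
    likewise for phi_j. So the system leaves invariant the leaf of all states
    (gamma_i(s_i), delta_j(r_j), lambda, mu), on which it becomes
<<
      s_i'    = - (sum_j u_ij G_j(r_j) + lambda)
      r_j'    = sum_i u_ij F_i(s_i) + mu
      lambda' = sum_i F_i(s_i) - 1
      mu'     = - (sum_j G_j(r_j) - 1).
>>
    A fully mixed equilibrium makes every pure strategy of either player equally
    good ([fully_mixed_nash_indifferent]): all entries of U q and of U^T p equal
    the value v of the game. Replacing G_j by G_j - q_j, F_i by F_i - p_i, lambda
    by lambda + v and mu by mu + v absorbs all the constants, and the reduced
    system reads x' = J phi(x) with J constant and antisymmetric and phi acting
    coordinatewise. Each phi_a is strictly increasing, because an ascent curve
    starting at a non-stationary point never reaches a stationary one
    ([ascent_speed_pos]), and each phi_a has a zero, because the initialization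
    is safe.

    Let P_a be a primitive of phi_a. The energy sum_a P_a(x_a) is conserved, J
    being antisymmetric, and it is coercive, each P_a growing at least linearly.
    Hence orbits are bounded. Cutting phi off outside a large cube gives a globally
    Lipschitz field with the same orbits below a given energy; its flow comes from
    Picard iteration, and these flows glue to a global flow.

    The field is divergence free in a strong sense: its a-th component does not
    involve x_a. Recurrence follows by counting, with no appeal to an invariant
    measure. On the lattice (1/n) Z^k, adding to the a-th coordinate the rounded
    increment of one Euler step is injective; composing such shears gives an
    injective map of the lattice which shadows the flow ([lattice_flow_approx]).
    If a set E never returns close to itself, the first J iterates of the lattice
    points near E are disjoint and stay in a fixed cube, so there are few such
    points, and E is covered by cubes of total volume O(1/J) ([return_cover]).
    The non-recurrent points form a countable union of such sets E
    ([nonrecurrent_wandering]). This is [separable_flow_recurrent]. That the whole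
    space is not null is again proved by counting grid points.

    Finally the leaf is diffeomorphic to R^k. The clock s_i of a state on the leaf
    is recovered as F_i^-1(f_i(theta_i)), a formula which makes sense on an open
    set of the state space. Smoothness of gamma_i and of this chart is obtained by
    bootstrapping: a function whose derivatives are expressed smoothly through the
    function itself is of class C^k for all k ([smooth_along_ascent],
    [Ck_on_implicit]). *)

(** * Calculus on the line *)

Section RealCalculus.
Variable R : realType.
Implicit Types (f g df dg w dw F G : R -> R) (a b t : R).

Lemma is_derive_continuous f (d t : R) : is_derive t 1 f d -> {for t, continuous f}.
Proof.
by move=> fd; apply/differentiable_continuous/derivable1_diffP; case: fd.
Qed.

Lemma deriv_ge0_le f df a b : a <= b ->
  (forall t, a <= t <= b -> is_derive t 1 f (df t)) ->
  (forall t, a <= t <= b -> 0 <= df t) -> f a <= f b.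
Proof.
move=> ab fd df0.
have [|| c cab E] := @MVT_segment R f df a b ab.
- by move=> x; rewrite in_itv/= => /andP[xa xb]; apply: fd; rewrite !ltW.
- apply: continuous_in_subspaceT => x; rewrite inE/= in_itv/= => xab.
  exact: (is_derive_continuous (fd x xab)).
- rewrite -subr_ge0 E; apply: mulr_ge0; rewrite ?subr_ge0//; apply: df0.
  by move: cab; rewrite in_itv.
Qed.

Lemma deriv_le_le f g df dg a b : a <= b ->
  (forall t, a <= t <= b -> is_derive t 1 f (df t)) ->
  (forall t, a <= t <= b -> is_derive t 1 g (dg t)) ->
  (forall t, a <= t <= b -> df t <= dg t) -> f b - f a <= g b - g a.
Proof.
move=> ab fd gd le.
have := @deriv_ge0_le (g - f) (fun t => dg t - df t) a b ab.
rewrite !fctE => H.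
suff : g a - f a <= g b - f b by lra.
apply: H => t tab; last by rewrite subr_ge0 le.
by have := fd t tab; have := gd t tab => ? ?; apply: is_deriveB.
Qed.

Lemma deriv_norm_le f g df dg a b : a <= b ->
  (forall t, a <= t <= b -> is_derive t 1 f (df t)) ->
  (forall t, a <= t <= b -> is_derive t 1 g (dg t)) ->
  (forall t, a <= t <= b -> `|df t| <= dg t) -> `|f b - f a| <= g b - g a.
Proof.
move=> ab fd gd le; rewrite ler_norml; apply/andP; split; last first.
  by apply: deriv_le_le fd gd _ => // t /le; rewrite ler_norml => /andP[].
have := @deriv_le_le (- f) g (fun t => - df t) dg a b ab; rewrite !fctE => H.
suff : - f b - - f a <= g b - g a by lra.
apply: H => // t tab.
  by have := fd t tab => ?; apply: is_deriveN.
by have := le t tab; rewrite ler_norml => /andP[]; lra.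
Qed.

Lemma is_derive_mull (K t : R) : is_derive t 1 ( *%R K) K.
Proof.
have := @is_deriveZ R R R id K t 1 1 (is_derive_id t 1).
by rewrite /GRing.scale/= mulr1.
Qed.

Lemma is_derive_expRM (K t : R) :
  is_derive t 1 (fun s => expR (K * s)) (K * expR (K * t)).
Proof.
have h : is_derive t 1 (fun s : R => K * s) K.
  exact: is_derive_mull.
have := @is_derive1_comp R expR (fun s => K * s) t _ _ (is_derive_expR (K * t)) h.
by rewrite mulrC.
Qed.

Lemma is_derive_opp_comp f d t :
  is_derive (- t) 1 f d -> is_derive t 1 (fun s => f (- s)) (- d).
Proof.
move=> fd; have := @is_derive1_comp R f -%R t d (-1) fd (is_deriveNid _ _).
by rewrite mulrN1.
Qed.

(** The function w(t) exp(- K t) is nonincreasing. *)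
Lemma gronwall w dw (K a b : R) : a <= b ->
  (forall t, a <= t <= b -> is_derive t 1 w (dw t)) ->
  (forall t, a <= t <= b -> dw t <= K * w t) ->
  w b <= w a * expR (K * (b - a)).
Proof.
move=> ab wd le.
pose u := (w * (fun s => expR (- K * s)))%R.
have := @deriv_ge0_le (- u)
  (fun t => - (w t * (- K * expR (- K * t)) + expR (- K * t) * dw t)) a b ab.
rewrite /u !fctE => H.
have {}H : w b * expR (- K * b) <= w a * expR (- K * a).
  rewrite -lerN2; apply: H => t tab.
    have := wd t tab; have := is_derive_expRM (- K) t => h1 h2.
    by apply: is_deriveN; apply: is_derive_eq.
  have := le t tab; have := expR_gt0 (- K * t).
  move: (expR _) => e e0 h; rewrite oppr_ge0.
  have : e * (dw t - K * w t) <= 0 by apply: mulr_ge0_le0; lra.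
  by apply: le_trans; rewrite le_eqVlt; apply/orP; left; apply/eqP; ring.
have := ler_wpM2r (expR_ge0 (K * b)) H.
by rewrite -!mulrA -!expRD mulNr addNr expR0 mulr1 mulNr mulrBr addrC.
Qed.

Lemma gronwall_back w dw (K a b : R) : a <= b ->
  (forall t, a <= t <= b -> is_derive t 1 w (dw t)) ->
  (forall t, a <= t <= b -> - K * w t <= dw t) ->
  w a <= w b * expR (K * (b - a)).
Proof.
move=> ab wd le.
have := @gronwall (fun s => w (- s)) (fun s => - dw (- s)) K (- b) (- a).
rewrite !opprK addrC; apply; first lra.
  move=> t tab; apply: is_derive_opp_comp; apply: wd; lra.
move=> t tab; have -> : K * w (- t) = - (- K * w (- t)) by ring.
by rewrite lerN2; apply: le; lra.
Qed.

Lemma gronwall_abs w dw (K t : R) :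
  (forall t, is_derive t 1 w (dw t)) -> (forall t, `|dw t| <= K * w t) ->
  w t <= w 0 * expR (K * `|t|).
Proof.
move=> wd le; have [t0|t0] := leP 0 t.
  have := @gronwall w dw K 0 t t0; rewrite subr0 (ger0_norm t0); apply => // s _.
  exact: le_trans (ler_norm _) (le s).
have := @gronwall_back w dw K t 0 (ltW t0); rewrite sub0r (ltr0_norm t0); apply => // s _.
by have := le s; rewrite ler_norml -mulNr => /andP[].
Qed.

(** The estimate that makes Picard iteration contract in the norm weighted by
    exp(- K |t|). *)
Lemma exp_growth_bound f df (B K t : R) :
  (forall t, is_derive t 1 f (df t)) -> f 0 = 0 -> 0 <= B ->
  (forall t, `|df t| <= B * (K * expR (K * `|t|))) ->
  `|f t| <= B * expR (K * `|t|).
Proof.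
suff pos (f' df' : R -> R) (t' : R) : 0 <= t' -> (forall t, is_derive t 1 f' (df' t)) ->
   f' 0 = 0 -> 0 <= B -> (forall t, `|df' t| <= B * (K * expR (K * `|t|))) ->
  `|f' t'| <= B * expR (K * t').
  move=> fd f0 B0 le; have [t0|t0] := leP 0 t; first by rewrite (ger0_norm t0); exact: (pos f df t t0 fd f0 B0 le).
  have := @pos (fun s => f (- s)) (fun s => - df (- s)) (- t).
  rewrite (ltr0_norm t0) opprK oppr0; apply => //.
  - by rewrite oppr_ge0 ltW.
  - by move=> s; apply: is_derive_opp_comp.
  by move=> s; rewrite normrN -[X in expR (K * X)]normrN; apply: le.
move=> t0 fd f0 B0 le.
have := @deriv_norm_le f' (fun s => B * expR (K * s)) df'
  (fun s => B * (K * expR (K * s))) 0 t' t0.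
rewrite f0 subr0 mulr0 expR0 mulr1 => H.
apply: (@le_trans _ _ (B * expR (K * t') - B)); last by rewrite lerBlDr lerDl.
apply: H => // s /andP[s0 _]; last by have := le s; rewrite (ger0_norm s0).
have h := is_derive_expRM K s.
exact: (@is_deriveZ R R R (fun s => expR (K * s)) B s 1 _ h).
Qed.

Lemma deriv0_eq f g df a b :
  (forall t, a < t < b -> is_derive t 1 f (df t)) ->
  (forall t, a < t < b -> is_derive t 1 g (df t)) ->
  forall s t, a < s < b -> a < t < b -> f t - f s = g t - g s.
Proof.
move=> fd gd s t; wlog st : s t / s <= t.
  move=> W hs ht; case: (lerP s t) => st; first exact: W.
  have := W t s (ltW st) ht hs; lra.
move=> hs ht; apply/eqP; rewrite eq_le; apply/andP.
have I x : s <= x <= t -> a < x < b by lra.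
by split; apply: (@deriv_le_le _ _ df df) => // x /I xab; auto.
Qed.

(** The fundamental theorem of calculus for integrals from -1 covers the times
    t > -1; the other times are reached by reflection. *)
Lemma antiderivative_right f : continuous f ->
  exists F : R -> R, forall t, -1 < t -> is_derive t 1 F (f t).
Proof.
move=> fc.
exists (fun x => (\int[lebesgue_measure]_(t in [set` Interval (BLeft (-1)) (BRight x)]) f t)%R) => t t1.
have [||||h1 h2] := @continuous_FTC1 R f (BLeft (-1)) t (t + 1) _ _ _ _.
- lra.
- apply: continuous_compact_integrable; first exact: segment_compact.
  exact: continuous_subspaceT.
- by rewrite /= lte_fin.
- exact: fc.
- by rewrite derive1E in h2; exact: DeriveDef h1 h2.
Qed.

(** A right antiderivative F of f and the reflection of one of f o (- id) are both
    antiderivatives on ]-1, 1[, where they differ by a constant; so they can be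
    glued at 0. *)
Lemma antiderivative f : continuous f ->
  exists F : R -> R, F 0 = 0 /\ forall t, is_derive t 1 F (f t).
Proof.
move=> fc; have [F Fd] := antiderivative_right fc.
have [|G Gd] := @antiderivative_right (f \o -%R).
  by move=> x; apply: continuous_comp; [exact: opp_continuous|exact: fc].
have Gd' t : t < 1 -> is_derive t 1 (fun s => - G (- s)) (f t).
  move=> t1; have /Gd : -1 < - t by lra.
  move/is_derive_opp_comp => /= h; rewrite -[t in f t]opprK -[f _]opprK.
  exact: (@is_deriveN _ _ _ _ _ _ _ h).
pose H t := if 0 <= t then F t - F 0 else - G (- t) + G 0.
have dcst (h : R -> R) (c d s : R) : is_derive s 1 h d -> is_derive s 1 (fun x => h x + c) d.
  by move=> hd; have := @is_deriveD _ _ _ h (cst c) s 1 _ _ hd (is_derive_cst _ _ _); rewrite addr0.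
exists H; split; first by rewrite /H lexx subrr.
(* Any threshold in ]-1, 0[ works: above it F is defined, below it t < 0. *)
move=> t; case: (lerP t (-(1/2))) => t1.
  apply: (@near_eq_is_derive _ _ _ (fun s => - G (- s) + G 0)); last first.
    by apply: dcst; apply: Gd'; lra.
  have : t < 0 by lra.
  by move=> /lt_nbhsl; apply: filterS => s s0; rewrite /H leNgt s0.
apply: (@near_eq_is_derive _ _ _ (fun s => F s - F 0)); last first.
  by apply: dcst; apply: Fd; lra.
have : -1 < t by lra.
move=> /lt_nbhsr; apply: filterS => s s0; rewrite /H; case: ifPn => //.
rewrite -ltNge => sn.
have E : F s - F 0 = - G (- s) - - G (- 0).
  apply: (@deriv0_eq F (fun s => - G (- s)) f (-1) 1) => [x|x||]; try lra.
  - by move=> /andP[? ?]; apply: Fd.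
  - by move=> /andP[? ?]; apply: Gd'.
by rewrite E oppr0 opprK.
Qed.

End RealCalculus.

(** * The sup norm and geometric limits *)

Section RowNorm.
Variables (R : realType) (k : nat).
Implicit Types x y : 'rV[R]_k.

Lemma norm_coord_le x i : `|x 0 i| <= `|x|.
Proof.
rewrite [leRHS]/Num.Def.normr/= mx_normrE.
exact: (le_bigmax _ (fun ij : 'I_1 * 'I_k => `|x ij.1 ij.2|) (0, i)).
Qed.

Lemma norm_row_le x (c : R) : 0 <= c -> (forall i, `|x 0 i| <= c) -> `|x| <= c.
Proof.
move=> c0 le; rewrite [leLHS]/Num.Def.normr/= mx_normrE bigmax_le//= => -[i j] _ /=.
by rewrite ord1; apply: le.
Qed.

Lemma norm_coordB_le x y i : `|x 0 i - y 0 i| <= `|x - y|.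
Proof. by have := norm_coord_le (x - y) i; rewrite !mxE. Qed.

Lemma norm_rowB_le x y (c : R) : 0 <= c ->
  (forall i, `|x 0 i - y 0 i| <= c) -> `|x - y| <= c.
Proof. by move=> c0 le; apply: norm_row_le => // i; rewrite !mxE. Qed.

End RowNorm.

Lemma lipschitz_continuous (R : realType) (U W : normedModType R) (f : U -> W)
    (K : R) : (forall x y, `|f x - f y| <= K * `|x - y|) -> continuous f.
Proof.
move=> Kf x; apply/cvgrPdist_lt => e e0.
have K1 : 0 < `|K| + 1 by rewrite ltr_wpDl.
near=> y.
have xy : `|x - y| < e / (`|K| + 1).
  by near: y; apply: cvgr_dist_lt => //; rewrite divr_gt0.
apply: le_lt_trans (Kf x y) _.
rewrite (@le_lt_trans _ _ ((`|K| + 1) * `|x - y|))//.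
  by rewrite ler_wpM2r// (le_trans (ler_norm _))// lerDl.
by rewrite mulrC -ltr_pdivlMr.
Unshelve. all: by end_near. Qed.

Section LipschitzOfDerivative.
Variable R : realType.

Lemma deriv_bounded_lipschitz (f df : R -> R) (K a b : R) :
  (forall t : R, is_derive t 1 f (df t)) -> (forall t, `|df t| <= K) ->
  `|f a - f b| <= K * `|a - b|.
Proof.
move=> fd le; wlog ab : a b / a <= b.
  move=> W; have [/W//|/ltW/W] := leP a b.
  by rewrite distrC [X in K * X]distrC.
rewrite distrC [X in K * X]distrC (ger0_norm (_ : 0 <= b - a)) ?subr_ge0//.
rewrite mulrBr; apply: (@deriv_norm_le R f ( *%R K) df (fun=> K)) => // t _.
exact: is_derive_mull.
Qed.

End LipschitzOfDerivative.

Section GeometricLimit.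
Variables (R : realType) (k : nat).

Lemma geometric_to0 (x C : R) : (forall n, x <= C / 2 ^+ n) -> x <= 0.
Proof.
move=> xC; rewrite leNgt; apply/negP => x0.
have C0 : 0 < C by have := lt_le_trans x0 (xC 0%N); rewrite expr0 divr1.
pose n := (Num.truncn (C / x)).+1.
have : C / x < n%:R by rewrite /n truncnS_gt.
rewrite ltr_pdivrMr// => h1.
have := xC n; rewrite ler_pdivlMr ?exprn_gt0// => h2.
have : (n%:R : R) < 2 ^+ n by rewrite -natrX ltr_nat ltn_expl.
rewrite -(ltr_pM2l x0) => h3; lra.
Qed.

Lemma geometric_cvg (u : nat -> R) (C : R) :
  (forall n, `|u n.+1 - u n| <= C / 2 ^+ n) ->
  exists l, forall n, `|l - u n| <= 2 * C / 2 ^+ n.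
Proof.
move=> uC.
have C0 : 0 <= C by have := le_trans (normr_ge0 _) (uC 0%N); rewrite expr0 divr1.
have far n p : `|u (n + p)%N - u n| <= 2 * C / 2 ^+ n - 2 * C / 2 ^+ (n + p).
  elim: p => [|p IH]; first by rewrite addn0 !subrr normr0.
  rewrite addnS; have := uC (n + p)%N.
  have -> : 2 * C / 2 ^+ (n + p).+1 = C / 2 ^+ (n + p).
    by rewrite exprS invfM mulrA; congr (_ * _); field.
  have := ler_distD (u (n + p)%N) (u (n + p).+1) (u n); lra.
have pos n : 0 <= 2 * C / 2 ^+ n by rewrite divr_ge0// mulr_ge0.
have /cvg_ex[l ul] : cvgn u.
  apply/cauchy_cvgP/cauchy_exP => e e0.
  have [n0 hn] : exists n0, 2 * C / 2 ^+ n0 < e / 2.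
    apply: contrapT => /forallNP h.
    have : e / 2 <= 0 by apply: (@geometric_to0 _ (2 * C)) => n; rewrite leNgt; apply/negP.
    by rewrite leNgt divr_gt0.
  exists (u n0), n0 => // q /= nq; have := far n0 (q - n0)%N; rewrite subnKC// => h.
  rewrite /ball/= distrC; have := pos q; lra.
exists l => n.
have : (fun p => `|u p - u n|) @ \oo --> `|l - u n|.
  by apply: cvg_norm; apply: cvgB => //; exact: cvg_cst.
move=> h; rewrite -(cvg_lim _ h)//; apply: limr_le; first exact: cvgP h.
exists n => // p /= np; have := far n (p - n)%N; rewrite subnKC// => {}h.
by apply: le_trans h _; rewrite lerBlDr lerDl.
Qed.

End GeometricLimit.

(** * Picard iteration for bounded Lipschitz fields *)

Lemma half_geometric (R : realType) (a : R) n : a / 2 ^+ n = 2 * (a / 2 ^+ n.+1).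
Proof. by rewrite exprS invfM mulrCA [2 * _]mulrA divff// mul1r. Qed.

(** Derivatives are taken coordinate by coordinate, which keeps all the analysis of
    the flow one-dimensional. *)
Definition solves (R : realType) (k : nat) (v : 'rV[R]_k -> 'rV[R]_k)
    (c : R -> 'rV[R]_k) :=
  forall i (t : R), is_derive t 1 (fun s => c s 0 i) (v (c t) 0 i).

Section LipschitzFlow.
Variables (R : realType) (k : nat) (v : 'rV[R]_k -> 'rV[R]_k) (L V : R).
Hypotheses (L_gt0 : 0 < L) (V_ge0 : 0 <= V).
Hypothesis v_lip : forall x y, `|v x - v y| <= L * `|x - y|.
Hypothesis v_bnd : forall x, `|v x| <= V.

(** A total choice of primitive, so that Picard iterates can be defined without
    carrying continuity proofs. *)
Definition primitive (f : R -> R) : R -> R :=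
  xget (fun=> 0) [set F : R -> R | F 0 = 0 /\ forall t : R, is_derive t 1 F (f t)].

Lemma primitiveP f : continuous f -> primitive f 0 = 0 /\
  forall t : R, is_derive t 1 (primitive f) (f t).
Proof.
move=> fc; have [F HF] := antiderivative fc.
exact: (@xgetPex _ (fun=> 0) [set F : R -> R | F 0 = 0 /\ forall t : R, is_derive t 1 F (f t)] (ex_intro _ F HF)).
Qed.

Fixpoint picard (x : 'rV[R]_k) (n : nat) : R -> 'rV[R]_k :=
  if n is n'.+1 then
    fun t => \row_i (x 0 i + primitive (fun s => v (picard x n' s) 0 i) t)
  else fun=> x.

(** All iterates are V-Lipschitz, the field being bounded by V; so the integrands
    are continuous. *)
Lemma lipschitz_field_continuous (c : R -> 'rV[R]_k) i :
  (forall s t, `|c s - c t| <= V * `|s - t|) ->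
  continuous (fun s => v (c s) 0 i).
Proof.
move=> clip; apply: (@lipschitz_continuous R R R _ (L * V)) => s t.
apply: le_trans (norm_coordB_le _ _ _) _; apply: le_trans (v_lip _ _) _.
by rewrite -mulrA ler_wpM2l// ltW.
Qed.

Lemma is_deriveDcst (f : R -> R) (a d t : R) :
  is_derive t 1 f d -> is_derive t 1 (fun s => a + f s) d.
Proof.
move=> fd; have := @is_deriveD R R R (cst a) f t 1 0 d (is_derive_cst _ _ _) fd.
by rewrite add0r.
Qed.

Lemma picard_step_derive (x : 'rV[R]_k) (c : R -> 'rV[R]_k) i (t : R) :
  (forall s t, `|c s - c t| <= V * `|s - t|) ->
  is_derive t 1 (fun s => x 0 i + primitive (fun s => v (c s) 0 i) s) (v (c t) 0 i).
Proof.
move=> clip; apply: is_deriveDcst.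
exact: (primitiveP (lipschitz_field_continuous (i := i) clip)).2.
Qed.

Lemma picard_step_lip (x : 'rV[R]_k) (c : R -> 'rV[R]_k) :
  (forall s t, `|c s - c t| <= V * `|s - t|) ->
  let d t := (\row_i (x 0 i + primitive (fun s => v (c s) 0 i) t)) : 'rV[R]_k in
  forall s t, `|d s - d t| <= V * `|s - t|.
Proof.
move=> clip d s t; apply: norm_rowB_le; first by rewrite mulr_ge0.
move=> i; rewrite !mxE.
apply: (@deriv_bounded_lipschitz R (fun s => x 0 i + primitive (fun s => v (c s) 0 i) s) (fun t => v (c t) 0 i)).
  by move=> u; apply: picard_step_derive.
by move=> u; apply: le_trans (v_bnd (c u)); exact: norm_coord_le.
Qed.

Lemma picard_lip x n s t : `|picard x n s - picard x n t| <= V * `|s - t|.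
Proof.
elim: n s t => [|n IH] s t /=; first by rewrite subrr normr0 mulr_ge0.
exact: picard_step_lip.
Qed.

(** In the norm weighted by exp(- 2 L |t|), a Picard step halves distances, over
    all times at once; so solutions are global without any continuation argument. *)
Lemma picard_contract (x : 'rV[R]_k) (c d : R -> 'rV[R]_k) (B : R) i (t : R) : 0 <= B ->
  (forall s t, `|c s - c t| <= V * `|s - t|) ->
  (forall s t, `|d s - d t| <= V * `|s - t|) ->
  (forall s, `|c s - d s| <= 2 * B * expR (2 * L * `|s|)) ->
  `|(x 0 i + primitive (fun s => v (c s) 0 i) t) -
    (x 0 i + primitive (fun s => v (d s) 0 i) t)| <= B * expR (2 * L * `|t|).
Proof.
move=> B0 cl dl cd.
pose D := (primitive (fun s => v (c s) 0%R i) - primitive (fun s => v (d s) 0%R i))%R.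
have -> : (x 0 i + primitive (fun s => v (c s) 0 i) t) -
    (x 0 i + primitive (fun s => v (d s) 0 i) t) = D t.
  by rewrite /D !fctE; ring.
have [c0 cdv] := primitiveP (lipschitz_field_continuous (i := i) cl).
have [d0 ddv] := primitiveP (lipschitz_field_continuous (i := i) dl).
apply: (@exp_growth_bound R D (fun t => v (c t) 0 i - v (d t) 0 i)) => //.
  by rewrite /D !fctE c0 d0 subrr.
move=> s; apply: le_trans (norm_coordB_le _ _ _) _.
apply: le_trans (v_lip _ _) _.
apply: le_trans (ler_wpM2l (ltW L_gt0) (cd s)) _.
by rewrite le_eqVlt; apply/orP; left; apply/eqP; ring.
Qed.

Lemma picard_cauchy x n t :
  `|picard x n.+1 t - picard x n t| <= (V / L) / 2 ^+ n * expR (2 * L * `|t|).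
Proof.
elim: n t => [|n IH] t.
  rewrite expr0 divr1 [picard x 1 t]/=.
  apply: norm_rowB_le; first by rewrite mulr_ge0 ?expR_ge0// divr_ge0// ltW.
  move=> i; rewrite !mxE addrC addKr.
  have [c0 cdv] := primitiveP (lipschitz_field_continuous (c := fun=> x) (i := i) (fun s t => picard_lip x 0 s t)).
  apply: (@exp_growth_bound R _ (fun=> v x 0 i)) => //.
    by rewrite divr_ge0// ltW.
  move=> s; apply: le_trans (norm_coord_le _ _) _; apply: le_trans (v_bnd _) _.
  have -> : V / L * (2 * L * expR (2 * L * `|s|)) = V * (2 * expR (2 * L * `|s|)).
    by field; rewrite gt_eqF.
  rewrite ler_peMr//.
  have : 1 <= expR (2 * L * `|s|) by rewrite -expR0 ler_expR !mulr_ge0// ltW.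
  lra.
apply: norm_rowB_le.
  by rewrite !mulr_ge0 ?expR_ge0 ?invr_ge0 ?exprn_ge0// ltW.
move=> i; rewrite [picard x n.+2 t]/= [picard x n.+1 t]/= !mxE.
apply: (@picard_contract x (picard x n.+1) (picard x n)) => //.
- by rewrite !mulr_ge0 ?expR_ge0 ?invr_ge0 ?exprn_ge0// ltW.
- exact: picard_lip.
- exact: picard_lip.
move=> s; apply: le_trans (IH s) _.
rewrite le_eqVlt; apply/orP; left; apply/eqP; congr (_ * _).
exact: half_geometric.
Qed.

(** The iterates converge at each time at a geometric rate; the limit c is again
    V-Lipschitz and satisfies the integral equation [fix_eq]. *)
Lemma lipschitz_ode_solution x : exists c : R -> 'rV[R]_k,
  c 0 = x /\ solves v c.
Proof.
have lim t i : exists l, forall n, `|l - picard x n t 0 i| <=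
    2 * (V / L * expR (2 * L * `|t|)) / 2 ^+ n.
  apply: geometric_cvg => n; apply: le_trans (norm_coordB_le _ _ _) _.
  by apply: le_trans (picard_cauchy x n t) _; rewrite mulrAC.
pose c t : 'rV[R]_k := \row_i (projT1 (cid (lim t i))).
have cP t n : `|c t - picard x n t| <= 2 * (V / L * expR (2 * L * `|t|)) / 2 ^+ n.
  apply: norm_rowB_le.
    by rewrite !mulr_ge0 ?expR_ge0 ?invr_ge0 ?exprn_ge0// ltW.
  by move=> i; rewrite mxE; exact: (projT2 (cid (lim t i))).
have clip s t : `|c s - c t| <= V * `|s - t|.
  rewrite -subr_le0; apply: (@geometric_to0 _ _ (2 * (V / L * expR (2 * L * `|s|)) +
     2 * (V / L * expR (2 * L * `|t|)))) => n.
  have h1 := cP s n; have h2 := cP t n; have h3 := picard_lip x n s t.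
  have h4 := ler_distD (picard x n s) (c s) (c t).
  have h5 := ler_distD (picard x n t) (picard x n s) (c t).
  rewrite (distrC (picard x n t)) in h5.
  rewrite mulrDl; lra.
have fix_eq t i : c t 0 i = x 0 i + primitive (fun s => v (c s) 0 i) t.
  apply/eqP; rewrite -subr_eq0 -normr_le0.
  apply: (@geometric_to0 _ _ (2 * (V / L * expR (2 * L * `|t|)))) => n.
  have h1 : `|c t 0 i - picard x n.+1 t 0 i| <= (V / L * expR (2 * L * `|t|)) / 2 ^+ n.
    apply: le_trans (norm_coordB_le _ _ _) _; apply: le_trans (cP t n.+1) _.
    rewrite le_eqVlt; apply/orP; left; apply/eqP.
    by rewrite [RHS]half_geometric !mulrA.
  have h2 : `|(x 0 i + primitive (fun s => v (c s) 0 i) t) - picard x n.+1 t 0 i| <=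
     (V / L / 2 ^+ n) * expR (2 * L * `|t|).
    rewrite [picard x n.+1 t]/= mxE; apply: picard_contract => //.
    - by rewrite !mulr_ge0 ?expR_ge0 ?invr_ge0 ?exprn_ge0// ltW.
    - exact: picard_lip.
    move=> s; apply: le_trans (cP s n) _.
    by rewrite le_eqVlt; apply/orP; left; apply/eqP; ring.
  have := ler_distD (picard x n.+1 t 0 i) (c t 0 i) (x 0 i + primitive (fun s => v (c s) 0 i) t).
  rewrite [X in _ <= _ + X]distrC.
  have -> : 2 * (V / L * expR (2 * L * `|t|)) / 2 ^+ n =
    (V / L * expR (2 * L * `|t|)) / 2 ^+ n + (V / L / 2 ^+ n) * expR (2 * L * `|t|) by ring.
  lra.
exists c; split.
  apply/rowP => i; rewrite fix_eq.
  by rewrite (primitiveP (lipschitz_field_continuous (i := i) clip)).1 addr0.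
move=> i t; rewrite (_ : (fun s => c s 0 i) =
  fun s => x 0 i + primitive (fun s => v (c s) 0 i) s); last first.
  by apply/funext => s; exact: fix_eq.
exact: picard_step_derive.
Qed.

Lemma lipschitz_flow_exists : exists Phi : R -> 'rV[R]_k -> 'rV[R]_k,
  (forall x, Phi 0 x = x) /\ forall x, solves v (Phi^~ x).
Proof.
have sol := lipschitz_ode_solution.
exists (fun t x => projT1 (cid (sol x)) t).
by split=> x; case: (projT2 (cid (sol x))).
Qed.

End LipschitzFlow.

(** * Uniqueness and dependence on the initial point *)

Lemma is_derive_shift_comp (R : realType) (f : R -> R) (a t d : R) :
  is_derive (t + a) 1 f d -> is_derive t 1 (fun s => f (s + a)) d.
Proof.
move=> fd.
have h : is_derive t 1 (fun s : R => s + a) 1.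
  have := @is_deriveD R R R id (cst a) t 1 1 0 (is_derive_id t 1) (is_derive_cst _ _ _).
  by rewrite addr0.
by have := @is_derive1_comp R f (fun s => s + a) t d 1 fd h; rewrite mulr1.
Qed.

Section SolutionDependence.
Variables (R : realType) (k : nat) (v : 'rV[R]_k -> 'rV[R]_k) (L : R).
Hypothesis L_ge0 : 0 <= L.
Hypothesis v_lip : forall x y, `|v x - v y| <= L * `|x - y|.

Lemma sqr_norm_le_sum (x : 'rV[R]_k) : `|x| ^+ 2 <= \sum_i (x 0 i) ^+ 2.
Proof.
have S0 : 0 <= \sum_i (x 0 i) ^+ 2 by apply: sumr_ge0 => i _; rewrite sqr_ge0.
rewrite -[leRHS]sqr_sqrtr// ler_sqr ?nnegrE ?sqrtr_ge0//.
apply: norm_row_le; first exact: sqrtr_ge0.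
move=> i; rewrite -sqrtr_sqr ler_sqrt//.
by rewrite (bigD1 i)//= lerDl sumr_ge0// => j _; rewrite sqr_ge0.
Qed.

(** The sup norm is not differentiable, so the Gronwall argument is run on the sum
    of the squared coordinate differences, at the cost of a factor k. *)
Lemma solution_dependence c d (t : R) : solves v c -> solves v d ->
  `|c t - d t| ^+ 2 <= k%:R * `|c 0 - d 0| ^+ 2 * expR (2 * k%:R * L * `|t|).
Proof.
move=> cs ds.
pose w s := \sum_i (c s 0 i - d s 0 i) ^+ 2.
pose dw s := \sum_i 2 * (c s 0 i - d s 0 i) * (v (c s) 0 i - v (d s) 0 i).
have wd (s : R) : is_derive s 1 w (dw s).
  rewrite /w /dw -fct_sumE; apply: is_derive_sum => i.
  have := is_deriveB (cs i s) (ds i s) => h.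
  have := @is_deriveX R R (fun s => c s 0 i - d s 0 i) 2 s 1 _ h.
  rewrite /GRing.scale/= expr1 => H.
  by rewrite (_ : (fun x => _) = (fun s : R => c s 0 i - d s 0 i) ^+ 2)//.
have normw s : `|c s - d s| ^+ 2 <= w s.
  apply: le_trans (sqr_norm_le_sum _) _; rewrite le_eqVlt; apply/orP; left; apply/eqP.
  by apply: eq_bigr => i _; rewrite !mxE.
have wle s : `|dw s| <= 2 * k%:R * L * w s.
  apply: le_trans (ler_norm_sum _ _ _) _.
  apply: (@le_trans _ _ (\sum_(i < k) 2 * L * w s)); last first.
    by rewrite sumr_const card_ord -mulr_natr le_eqVlt; apply/orP; left; apply/eqP; ring.
  apply: ler_sum => i _; rewrite !normrM normr_nat -!mulrA ler_wpM2l//.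
  apply: (@le_trans _ _ (`|c s - d s| * (L * `|c s - d s|))).
    apply: ler_pM => //; first exact: norm_coordB_le.
    by apply: le_trans (norm_coordB_le _ _ _) (v_lip _ _).
  by rewrite mulrCA ler_wpM2l// -expr2.
apply: le_trans (normw t) _; apply: le_trans (gronwall_abs _ wd wle) _.
rewrite ler_wpM2r ?expR_ge0//.
apply: (@le_trans _ _ (\sum_(i < k) `|c 0 - d 0| ^+ 2)).
  apply: ler_sum => i _; rewrite -[leLHS]real_normK ?num_real//.
  by rewrite ler_sqr ?nnegrE// norm_coordB_le.
by rewrite sumr_const card_ord mulr_natl.
Qed.

Lemma solution_unique c d (t : R) : solves v c -> solves v d -> c 0 = d 0 ->
  c t = d t.
Proof.
move=> cs ds cd; have := solution_dependence t cs ds.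
rewrite cd subrr normr0 expr0n mulr0 mul0r => h.
apply/eqP; rewrite -subr_eq0 -normr_eq0 -sqrf_eq0.
by rewrite eq_le h sqr_ge0.
Qed.

Lemma solves_shift c (a : R) : solves v c -> solves v (fun s => c (s + a)).
Proof. by move=> cs i t; apply: (@is_derive_shift_comp R (fun s => c s 0 i)); exact: cs. Qed.

Lemma solution_lipschitz (V : R) c s t : (forall x, `|v x| <= V) ->
  solves v c -> `|c s - c t| <= V * `|s - t|.
Proof.
move=> vV cs; apply: norm_rowB_le.
  by rewrite mulr_ge0// (le_trans _ (vV 0)).
move=> i; apply: (@deriv_bounded_lipschitz R (fun t => c t 0 i) (fun t => v (c t) 0 i)) => // u.
by apply: le_trans (vV (c u)); exact: norm_coord_le.
Qed.

(** Along the solution, v changes by at most L V h during a time h. *)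
Lemma euler_step_error (V : R) c (t h : R) i : (forall x, `|v x| <= V) ->
  solves v c -> 0 <= h ->
  `|c (t + h) 0 i - (c t 0 i + h * v (c t) 0 i)| <= L * V * h ^+ 2.
Proof.
move=> vV cs h0.
pose g s := (c (s + t) 0 i - s * v (c t) 0 i).
have gd (s : R) : is_derive s 1 g (v (c (s + t)) 0 i - v (c t) 0 i).
  rewrite /g; apply: is_deriveB; first exact: solves_shift.
  rewrite (_ : (fun s => s * _) = *%R (v (c t) 0 i)); last first.
    by apply/funext => u; rewrite mulrC.
  exact: is_derive_mull.
have qd (s : R) : is_derive s 1 (fun s => (L * V * h) * s) (L * V * h).
  exact: is_derive_mull.
have := @deriv_norm_le R g (fun s => (L * V * h) * s) _ _ 0 h h0
  (fun s _ => gd s) (fun s _ => qd s).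
rewrite /g !add0r mul0r subr0 mulr0 subr0 => H.
rewrite [h ^+ 2]expr2 mulrA [t + h]addrC.
have -> : c (h + t) 0 i - (c t 0 i + h * v (c t) 0 i) =
  c (h + t) 0 i - h * v (c t) 0 i - c t 0 i by ring.
apply: H => s /andP[s0 sh].
apply: le_trans (norm_coordB_le _ _ _) _; apply: le_trans (v_lip _ _) _.
rewrite -!mulrA ler_wpM2l//; apply: le_trans (solution_lipschitz _ _ vV cs) _.
by rewrite addrK ger0_norm// ler_wpM2l// (le_trans _ (vV 0)).
Qed.

End SolutionDependence.

(** * Injective lattice maps that shadow a flow *)

Ltac nonneg := repeat first [ done | apply: addr_ge0 | apply: mulr_ge0
  | exact: sqr_ge0 | rewrite invr_ge0 | exact: expR_ge0 | by apply: ltW ].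

Section LatticeShears.
Variables (R : realType) (k : nat) (v : 'rV[R]_k -> 'rV[R]_k) (L V : R).
Hypotheses (L_ge0 : 0 <= L) (V_ge0 : 0 <= V).
Hypothesis v_lip : forall x y, `|v x - v y| <= L * `|x - y|.
Hypothesis v_bnd : forall x, `|v x| <= V.
Hypothesis v_indep : forall (i : 'I_k) (x y : 'rV[R]_k),
  (forall j, j != i -> x 0 j = y 0 j) -> v x 0 i = v y 0 i.

(** The lattice (1/n) Z^k is handled through integer vectors, where injectivity is
    exact. *)
Definition lattice_pt (n : nat) (z : 'rV[int]_k) : 'rV[R]_k :=
  \row_i ((z 0 i)%:~R / n%:R).

(** One rounded Euler step of length h in the single coordinate i. *)
Definition shear (h : R) (n : nat) (i : 'I_k) (z : 'rV[int]_k) : 'rV[int]_k :=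
  \row_j (if j == i then z 0 j + Num.floor (n%:R * (h * v (lattice_pt n z) 0 i))
          else z 0 j).

(** The increment of coordinate i depends on the other coordinates only, by
    [v_indep]; those are unchanged, so the increment can be subtracted again. *)
Lemma shear_inj h n i : injective (shear h n i).
Proof.
move=> z z' /rowP E.
have Ej j : j != i -> z 0 j = z' 0 j.
  by move=> ji; have := E j; rewrite !mxE (negbTE ji).
have Ev : v (lattice_pt n z) 0 i = v (lattice_pt n z') 0 i.
  by apply: v_indep => j ji; rewrite !mxE Ej.
apply/rowP => j; have [->|ji] := eqVneq j i; last exact: Ej.
by have := E i; rewrite !mxE eqxx Ev => /addIr.
Qed.

Definition shears (h : R) (n : nat) (s : seq 'I_k) (z : 'rV[int]_k) :=
  foldl (fun z i => shear h n i z) z s.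

Lemma shears_inj h n s : injective (shears h n s).
Proof.
elim: s => [|i s IH] z z' //= E; exact: shear_inj (IH _ _ E).
Qed.

(** Successive shears in distinct coordinates: a coordinate not yet treated is
    intact, and a treated one has received its Euler increment, up to the rounding
    error 1/n and to the displacement caused by the shears made before. *)
Lemma shears_bound h n s z : 0 <= h -> (0 < n)%N -> uniq s ->
  [/\ forall j, j \notin s -> shears h n s z 0 j = z 0 j,
      `|lattice_pt n (shears h n s z) - lattice_pt n z| <= h * V + n%:R^-1
    & forall j, j \in s ->
      `|lattice_pt n (shears h n s z) 0 j -
        (lattice_pt n z 0 j + h * v (lattice_pt n z) 0 j)| <=
      h * (L * (h * V + n%:R^-1)) + n%:R^-1].
Proof.
move=> h0 n0; have n0' : 0 < n%:R :> R by rewrite ltr0n.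
have ninv : 0 <= n%:R^-1 :> R by rewrite invr_ge0 ltW.
elim/last_ind: s => [|s i IH] us.
  by split => //=; rewrite subrr normr0 addr_ge0// mulr_ge0.
move: us; rewrite rcons_uniq => /andP[nis us]; have [h1 h2 h3] := IH us.
have E : shears h n (rcons s i) z = shear h n i (shears h n s z).
  by rewrite /shears foldl_rcons.
set w := shears h n s z in h1 h2 h3 E.
set f := n%:R * (h * v (lattice_pt n w) 0 i).
have fl : `|(Num.floor f)%:~R - f| <= 1.
  have := Num.Theory.ge_floor f; have := ltW (Num.Theory.floorD1_gt f).
  by rewrite intrD ler_norml; lra.
have wi : w 0 i = z 0 i by apply: h1.
have Ei : lattice_pt n (shear h n i w) 0 i =
    lattice_pt n z 0 i + (Num.floor f)%:~R / n%:R.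
  by rewrite !mxE eqxx wi intrD mulrDl.
have Ej j : j != i -> shear h n i w 0 j = w 0 j.
  by move=> ji; rewrite mxE (negbTE ji).
have Ep j : j != i -> lattice_pt n (shear h n i w) 0 j = lattice_pt n w 0 j.
  by move=> ji; rewrite [LHS]mxE [RHS]mxE Ej.
have dfl : `|(Num.floor f)%:~R / n%:R - h * v (lattice_pt n w) 0 i| <= n%:R^-1.
  have -> : h * v (lattice_pt n w) 0 i = f / n%:R.
    by rewrite /f; field; rewrite gt_eqF.
  by rewrite -mulrBl normrM (gtr0_norm (_ : 0 < n%:R^-1)) ?invr_gt0// ler_piMl.
rewrite E; split.
- move=> j; rewrite mem_rcons inE negb_or => /andP[ji js].
  by rewrite Ej// h1.
- apply: norm_rowB_le; first by rewrite addr_ge0// mulr_ge0.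
  move=> j; have [->|ji] := eqVneq j i.
    rewrite Ei addrC addKr.
    have vb : `|h * v (lattice_pt n w) 0 i| <= h * V.
      rewrite normrM (ger0_norm h0) ler_wpM2l//.
      by apply: le_trans (norm_coord_le _ _) (v_bnd _).
    have := ler_normD ((Num.floor f)%:~R / n%:R - h * v (lattice_pt n w) 0 i)
      (h * v (lattice_pt n w) 0 i).
    rewrite subrK; lra.
  apply: le_trans h2; apply: le_trans (norm_coordB_le _ _ j).
  by rewrite Ep.
- move=> j; rewrite mem_rcons inE => /predU1P[->|js].
    rewrite Ei.
    have hv : `|h * v (lattice_pt n w) 0 i - h * v (lattice_pt n z) 0 i| <=
        h * (L * (h * V + n%:R^-1)).
      rewrite -mulrBr normrM (ger0_norm h0) ler_wpM2l//.
      apply: le_trans (norm_coordB_le _ _ _) _; apply: le_trans (v_lip _ _) _.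
      by rewrite ler_wpM2l.
    have := ler_distD (h * v (lattice_pt n w) 0 i) ((Num.floor f)%:~R / n%:R)
      (h * v (lattice_pt n z) 0 i).
    have -> : lattice_pt n z 0 i + (Num.floor f)%:~R / n%:R -
      (lattice_pt n z 0 i + h * v (lattice_pt n z) 0 i) =
      (Num.floor f)%:~R / n%:R - h * v (lattice_pt n z) 0 i by ring.
    lra.
  have ji : j != i by apply: contraNneq nis => <-.
  by apply: le_trans (h3 j js); rewrite Ep.
Qed.

Definition lattice_step h n := shears h n (enum 'I_k).

(** Local error: 1 + h L amplifies the current error; h^2 comes from the Euler step
    and from the interplay of the shears, 1/n from rounding. *)
Lemma lattice_step_error h n c (t : R) z : 0 <= h -> (0 < n)%N -> solves v c ->
  `|lattice_pt n (lattice_step h n z) - c (t + h)| <=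
  (1 + h * L) * `|lattice_pt n z - c t| +
  (2 * L * V * h ^+ 2 + (h * L + 1) / n%:R).
Proof.
move=> h0 n0 cs.
have ninv : 0 <= n%:R^-1 :> R by rewrite invr_ge0.
have [_ _ H] := @shears_bound h n (enum 'I_k) z h0 n0 (enum_uniq _).
rewrite -/(lattice_step h n) in H.
apply: norm_rowB_le; first by nonneg.
move=> i; have := H i (mem_enum _ i); have := euler_step_error L_ge0 v_lip t i v_bnd cs h0.
set y := lattice_pt n z; set y' := lattice_pt n _.
have d1 : `|y 0 i - c t 0 i| <= `|y - c t| by exact: norm_coordB_le.
have d2 : `|h * v y 0 i - h * v (c t) 0 i| <= h * L * `|y - c t|.
  rewrite -mulrBr normrM (ger0_norm h0) -mulrA ler_wpM2l//.
  exact: le_trans (norm_coordB_le _ _ _) (v_lip _ _).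
move=> h1 h2.
have -> : y' 0 i - c (t + h) 0 i =
  (y' 0 i - (y 0 i + h * v y 0 i)) + (y 0 i - c t 0 i)
  + (h * v y 0 i - h * v (c t) 0 i)
  - (c (t + h) 0 i - (c t 0 i + h * v (c t) 0 i)) by ring.
apply: le_trans (ler_normB _ _) _.
apply: le_trans (lerD (ler_normD _ _) (lexx _)) _.
apply: le_trans (lerD (lerD (ler_normD _ _) (lexx _)) (lexx _)) _.
have -> : (1 + h * L) * `|y - c t| + (2 * L * V * h ^+ 2 + (h * L + 1) / n%:R) =
  (h * (L * (h * V + n%:R^-1)) + n%:R^-1) + `|y - c t| + h * L * `|y - c t| +
  L * V * h ^+ 2 by ring.
by apply: lerD => //; apply: lerD => //; apply: lerD.
Qed.

Lemma lattice_iter_error h n c z l : 0 <= h -> (0 < n)%N -> solves v c ->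
  `|lattice_pt n (iter l (lattice_step h n) z) - c (h *+ l)| <=
  expR (h * L * l%:R) *
  (`|lattice_pt n z - c 0| + l%:R * (2 * L * V * h ^+ 2 + (h * L + 1) / n%:R)).
Proof.
move=> h0 n0 cs; set E := 2 * L * V * h ^+ 2 + _.
have E0 : 0 <= E.
  by nonneg.
elim: l => [|l IH].
  by rewrite mulr0n mulr0 expR0 mul1r mul0r addr0.
rewrite iterS mulrSr.
apply: le_trans (lattice_step_error _ _ h0 n0 cs) _; rewrite -/E.
have -> : expR (h * L * l.+1%:R) = expR (h * L) * expR (h * L * l%:R).
  by rewrite -expRD -natr1; congr expR; ring.
have e1 : 1 + h * L <= expR (h * L) by exact: expR_ge1Dx.
have e2 : 1 <= expR (h * L * l%:R).
  by rewrite -expR0 ler_expR !mulr_ge0.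
have e3 : 1 <= expR (h * L) by rewrite -expR0 ler_expR mulr_ge0.
have := ler_pM (_ : 0 <= 1 + h * L) (normr_ge0 _) e1 IH.
have p1 : 0 <= 1 + h * L by nonneg.
move=> /(_ p1).
have e4 : E <= expR (h * L) * expR (h * L * l%:R) * E.
  by rewrite ler_peMl// -[leLHS]mulr1 ler_pM.
rewrite -natr1 mulrA => H.
apply: le_trans (lerD H e4) _.
by rewrite le_eqVlt; apply/orP; left; apply/eqP; ring.
Qed.

Lemma exists_large_nat (C e : R) : 0 < e ->
  exists2 n, (0 < n)%N & C / n%:R <= e.
Proof.
move=> e0; exists (Num.truncn (C / e)).+1 => //.
rewrite ler_pdivrMr ?ltr0n// mulrC -ler_pdivrMr// ltW//.
exact: truncnS_gt.
Qed.

(** First the time T is cut into m Euler steps, with m so large that the accumulated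
    h^2-errors are small over J periods; then the mesh 1/n is chosen, small with
    respect to m. *)
Lemma lattice_flow_approx (T d : R) (J : nat) : 0 <= T -> 0 < d ->
  exists n (sg : 'rV[int]_k -> 'rV[int]_k),
  [/\ (0 < n)%N, n%:R^-1 <= d, injective sg &
  forall c z, solves v c -> `|lattice_pt n z - c 0| <= n%:R^-1 ->
  forall j, (j <= J)%N -> `|lattice_pt n (iter j sg z) - c (T *+ j)| <= d].
Proof.
move=> T0 d0.
set M := expR (T * L * J%:R).
have M0 : 0 < M by exact: expR_gt0.
have d2 : 0 < d / 2 by rewrite divr_gt0.
have [m m0 Hm] := @exists_large_nat (M * (J%:R * (2 * L * V * T ^+ 2))) (d / 2) d2.
set h := T / m%:R.
have m0' : 0 < m%:R :> R by rewrite ltr0n.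
have h0 : 0 <= h by rewrite divr_ge0// ltW.
have [n n0 Hn] := @exists_large_nat (1 + M * (1 + J%:R * m%:R * (h * L + 1))) (d / 2) d2.
have n0' : 0 < n%:R :> R by rewrite ltr0n.
have hL : 0 <= h * L by rewrite mulr_ge0.
have Q0 : 0 <= M * (1 + J%:R * m%:R * (h * L + 1)).
  by nonneg.
exists n, (iter m (lattice_step h n)); split=> //.
- have : n%:R^-1 <= d / 2.
    apply: le_trans Hn; rewrite -[leLHS]mul1r; apply: ler_wpM2r; first by nonneg.
    by rewrite lerDl.
  lra.
- by elim: (m) => [|q IH] x y //= /shears_inj; exact: IH.
move=> c z cs zc j jJ.
have -> : iter j (iter m (lattice_step h n)) z = iter (j * m) (lattice_step h n) z.
  by elim: (j) => [//|q IH]; rewrite iterS mulSn iterD IH.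
have -> : T *+ j = h *+ (j * m).
  rewrite mulrnA mulrnAC; congr (_ *+ _).
  by rewrite -[h *+ m]mulr_natr /h divfK// gt_eqF.
apply: le_trans (lattice_iter_error _ _ h0 n0 cs) _.
have jm : (j * m)%:R <= J%:R * m%:R :> R by rewrite -natrM ler_nat leq_mul2r jJ orbT.
have eM : expR (h * L * (j * m)%:R) <= M.
  rewrite ler_expR; have -> : T * L * J%:R = h * L * (J%:R * m%:R).
    by rewrite /h; field; rewrite gt_eqF.
  by rewrite ler_wpM2l.
have E0 : 0 <= 2 * L * V * h ^+ 2 + (h * L + 1) / n%:R.
  by nonneg.
apply: (@le_trans _ _ (M * (n%:R^-1 + J%:R * m%:R * (2 * L * V * h ^+ 2 + (h * L + 1) / n%:R)))).
  apply: ler_pM => //.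
    by nonneg.
  by apply: lerD => //; rewrite ler_wpM2r.
have -> : M * (n%:R^-1 + J%:R * m%:R * (2 * L * V * h ^+ 2 + (h * L + 1) / n%:R)) =
  M * (J%:R * (2 * L * V * T ^+ 2)) / m%:R +
  M * (1 + J%:R * m%:R * (h * L + 1)) / n%:R.
  by rewrite /h; field; rewrite !gt_eqF.
rewrite [leRHS](splitr d) lerD//; apply: le_trans Hn.
by apply: ler_wpM2r; [nonneg|rewrite lerDr].
Qed.

End LatticeShears.

(** * Coverings of sets that do not return *)

Lemma leq_expn2r k m n : (m <= n -> m ^ k <= n ^ k)%N.
Proof. by case: k => [//|k] mn; rewrite leq_exp2r. Qed.

Section FiniteCovers.
Variables (R : realType) (k : nat).
Implicit Types (E : set 'rV[R]_k) (s : seq ('rV[R]_k * 'rV[R]_k)).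

(** Jordan content zero: finitely many boxes suffice. *)
Definition jordan_null E := forall e : R, 0 < e ->
  exists s, (forall x, E x -> exists2 b, b \in s & box b.1 b.2 x) /\
    \sum_(b <- s) box_volume b.1 b.2 <= e.

Lemma box_volume_ge0 (a b : 'rV[R]_k) : 0 <= box_volume a b.
Proof. by apply: prodr_ge0 => i _; rewrite le_max lexx. Qed.

Lemma floor_cell (n : nat) (x : 'rV[R]_k) : (0 < n)%N ->
  let a := \row_i Num.floor (n%:R * x 0 i) in
  `|lattice_pt R n a - x| <= n%:R^-1 /\
  box (lattice_pt R n a) (lattice_pt R n a + const_mx n%:R^-1) x.
Proof.
move=> n0 a; have n0' : 0 < n%:R :> R by rewrite ltr0n.
have H i : lattice_pt R n a 0 i <= x 0 i <= lattice_pt R n a 0 i + n%:R^-1.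
  rewrite !mxE -[X in _ + X]mul1r -mulrDl ler_pdivrMr// ler_pdivlMr//.
  rewrite [x 0 i * _]mulrC; have := Num.Theory.ge_floor (n%:R * x 0 i).
  by have := ltW (Num.Theory.floorD1_gt (n%:R * x 0 i)); rewrite intrD => -> ->.
split.
  apply: norm_rowB_le; first by rewrite invr_ge0 ltW.
  by move=> i; have := H i; rewrite ler_norml => /andP[*]; lra.
by move=> i; have := H i; rewrite [(_ + const_mx _) _ _]mxE [const_mx _ _ _]mxE.
Qed.

Lemma cell_volume (n : nat) (a : 'rV[R]_k) :
  box_volume a (a + const_mx n%:R^-1) = n%:R^-1 ^+ k.
Proof.
rewrite /box_volume (eq_bigr (fun=> n%:R^-1)); first by rewrite prodr_const card_ord.
move=> i _; have -> : (a + const_mx n%:R^-1) 0 i - a 0 i = n%:R^-1 by rewrite !mxE; ring.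
by rewrite max_r// invr_ge0.
Qed.

Section Return.
Variables (E : set 'rV[R]_k) (C n J : nat) (sg : 'rV[int]_k -> 'rV[int]_k).
Hypotheses (n_gt0 : (0 < n)%N) (J_gt0 : (0 < J)%N) (sg_inj : injective sg).
Let near z := exists2 e, E e & `|lattice_pt R n z - e| <= n%:R^-1.
Hypothesis sg_bnd : forall z j, near z -> (j < J)%N ->
  `|lattice_pt R n (iter j sg z)| <= C%:R.
Hypothesis sg_return : forall z j, near z -> (0 < j < J)%N -> ~ near (iter j sg z).

Let D := (2 * (n * C)).+1.
(* Integer vectors with entries in [- n C, n C] are coded by functions into
   [0, 2 n C], so as to be counted. *)
Let dec (g : {ffun 'I_k -> 'I_D}) : 'rV[int]_k := \row_i ((g i)%:Z - (n * C)%N%:Z).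
Let enc (z : 'rV[int]_k) : {ffun 'I_k -> 'I_D} :=
  [ffun i => inord (absz (z 0 i + (n * C)%N%:Z))].

Let lattice_bnd (z : 'rV[int]_k) i : `|lattice_pt R n z| <= C%:R -> `|z 0 i| <= (n * C)%N%:Z.
Proof.
move=> h; have := le_trans (norm_coord_le _ i) h.
rewrite mxE normrM normfV normr_nat ler_pdivrMr ?ltr0n// -natrM mulnC.
by rewrite -intr_norm -(ler_int R).
Qed.

Let encK (z : 'rV[int]_k) : `|lattice_pt R n z| <= C%:R -> dec (enc z) = z.
Proof.
move=> h; apply/rowP => i; rewrite !mxE ffunE.
have := lattice_bnd i h; rewrite ler_norml => /andP[h1 h2].
rewrite inordK ?gez0_abs; first by rewrite addrK.
  by rewrite -lerBlDr sub0r.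
by lia.
Qed.

Let dec_inj : injective dec.
Proof.
move=> g g' /rowP h; apply/ffunP => i; have := h i; rewrite !mxE => /addIr.
by move=> [] /val_inj.
Qed.

(** The lattice points near E have J disjoint families of iterates, all inside a
    cube with at most (2 n C + 1)^k points, so there are at most
    (2 n C + 1)^k / J of them; the cells of side 1/n at these points cover E. *)
Lemma return_cover : exists s,
  (forall x, E x -> exists2 b, b \in s & box b.1 b.2 x) /\
  \sum_(b <- s) box_volume b.1 b.2 <= (2 * C + 1)%:R ^+ k / J%:R.
Proof.
pose A : {set {ffun 'I_k -> 'I_D}} := [set g | `[< near (dec g) >]]%SET.
have cardA : (J * #|A| <= D ^ k)%N.
  rewrite -[X in (X * _)%N]card_ord -cardsT -cardsX.
  have -> : (D ^ k)%N = #|{: {ffun 'I_k -> 'I_D}}| by rewrite card_ffun !card_ord.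
  rewrite -cardsT.
  pose f (jg : 'I_J * {ffun 'I_k -> 'I_D}) := enc (iter jg.1 sg (dec jg.2)).
  rewrite -(@card_in_imset _ _ f).
    by apply: subset_leq_card; exact: finset.subsetT.
  (* The map sending (j, g) to the j-th iterate of g is injective. *)
  have main (j j' : 'I_J) g g' : (j <= j')%N -> near (dec g) -> near (dec g') ->
      f (j, g) = f (j', g') -> (j, g) = (j', g').
    move=> jj ng ng' /(congr1 dec); rewrite /f/= !encK; last first.
    - exact: sg_bnd.
    - exact: sg_bnd.
    rewrite -(subnKC jj) iterD => E0.
    have E1 : dec g = iter (j' - j) sg (dec g').
      by move: (iter (j' - j) _ _) E0 => w; elim: (val j) => [//|q IH] /= /sg_inj /IH.
    have [jj'|] := ltnP j j'.
      exfalso; apply: (@sg_return (dec g') (j' - j)%N) => //; last by rewrite -E1.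
      by rewrite subn_gt0 jj'/= (leq_ltn_trans (leq_subr _ _)).
    move=> j'j; have jE : j = j' by apply/val_inj/eqP; rewrite eqn_leq jj j'j.
    by move: E1; rewrite jE subnn /= => /dec_inj ->.
  move=> [j g] [j' g'] /finset.setXP[_]; rewrite inE => /asboolP ng /finset.setXP[_].
  rewrite inE => /asboolP ng'; have [jj|jj] := leqP j j'; first exact: main.
  by move=> h; apply/esym; apply: main => //; exact: ltnW.
exists [seq (lattice_pt R n (dec g), lattice_pt R n (dec g) + const_mx n%:R^-1) | g <- enum A].
split.
  move=> x Ex; have [h1 h2] := floor_cell x n_gt0.
  set a := (\row_i _) in h1 h2.
  have na : near a by exists x.
  have ea : dec (enc a) = a by apply: encK; exact: (sg_bnd (j := 0)).
  exists (lattice_pt R n (dec (enc a)), lattice_pt R n (dec (enc a)) + const_mx n%:R^-1).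
    by apply/mapP; exists (enc a) => //; rewrite mem_enum inE; apply/asboolP; rewrite ea.
  by rewrite ea.
rewrite big_map big_enum/= (eq_bigr (fun=> n%:R^-1 ^+ k)); last first.
  by move=> g _; rewrite cell_volume.
rewrite sumr_const -[_ *+ #|_|]mulr_natr ler_pdivlMr ?ltr0n//.
have n0' : 0 < n%:R :> R by rewrite ltr0n.
have -> : n%:R^-1 ^+ k * #|A|%:R * J%:R = (J * #|A|)%N%:R / n%:R ^+ k :> R.
  by rewrite natrM exprVn; ring.
rewrite ler_pdivrMr ?exprn_gt0// -!natrX -natrM ler_nat.
apply: leq_trans cardA _; rewrite -expnMn; apply: leq_expn2r.
by rewrite /D; nia.
Qed.

End Return.

End FiniteCovers.

(** * Lebesgue outer measure *)

Section NullSets.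
Variables (R : realType) (k : nat).

Lemma lebesgue_outer_ge0 (E : set 'rV[R]_k) : (0 <= lebesgue_outer E)%E.
Proof.
apply: le_ereal_inf_tmp => _ [P [a [b [_ ->]]]].
by apply: nneseries_ge0 => n _ _; rewrite lee_fin box_volume_ge0.
Qed.

(** The n-th set is covered by boxes of total volume at most e / 2^(n+1), and all
    the boxes are arranged in one sequence by coding pairs (n, position). *)
Lemma lebesgue_outer_null (E : nat -> set 'rV[R]_k) (F : set 'rV[R]_k) :
  (forall n, jordan_null (E n)) -> F `<=` \bigcup_n E n -> lebesgue_outer F = 0%E.
Proof.
move=> E0 FE; apply/eqP; rewrite eq_le lebesgue_outer_ge0 andbT.
apply/lee_addgt0Pr => e e0; rewrite add0e.
have cov n : exists s : seq ('rV[R]_k * 'rV[R]_k),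
    (forall x, E n x -> exists2 b, b \in s & box b.1 b.2 x) /\
    \sum_(b <- s) box_volume b.1 b.2 <= e / (2 ^ n.+1)%:R.
  by apply: E0; rewrite divr_gt0// ltr0n expn_gt0.
pose S n := projT1 (cid (cov n)).
have S1 n x : E n x -> exists2 b, b \in S n & box b.1 b.2 x.
  exact: (projT2 (cid (cov n))).1.
have S2 n : \sum_(b <- S n) box_volume b.1 b.2 <= e / (2 ^ n.+1)%:R.
  exact: (projT2 (cid (cov n))).2.
pose B (nj : nat * nat) := nth (0, 0) (S nj.1) nj.2.
pose B' m := if (pickle_inv m : option (nat * nat)) is Some nj then B nj else (0, 0).
pose P : pred nat := fun m => if (pickle_inv m : option (nat * nat)) is Some nj then (nj.2 < size (S nj.1))%N else false.
have PE : [set m | P m] = pickle @` ([set: nat] `*`` (fun n => `I_(size (S n)))).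
  apply/seteqP; split=> m; rewrite /P/=.
    case E1 : (pickle_inv m : option (nat * nat)) => [nj|//] njs; exists nj => //.
    have : ocancel (@pickle_inv _) (@pickle _ : nat * nat -> nat) := @pickle_invK _.
    by move=> /(_ m); rewrite E1.
  by move=> [nj [_ njs] <-]; rewrite pickleK_inv.
apply: (@le_trans _ _ (\sum_(m <oo | P m) (box_volume (B' m).1 (B' m).2)%:E)%E).
  apply: ereal_inf_lbound; exists P, (fun m => (B' m).1), (fun m => (B' m).2); split => //.
  move=> x /FE[n _ /S1[b bs bx]]; exists (pickle (n, index b (S n))).
    by rewrite /= /P pickleK_inv/= index_mem.
  by rewrite /B' pickleK_inv /B /= nth_index.
rewrite nneseries_esum; last by move=> m _; rewrite lee_fin box_volume_ge0.
rewrite PE esum_image; last by move=> x y _ _; apply: (pcan_inj (@pickleK _)).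
under eq_esum do rewrite /B' pickleK_inv.
apply: (@le_trans _ _ (\esum_(n in [set: nat]) \esum_(j in `I_(size (S n)))
    (box_volume (B (n, j)).1 (B (n, j)).2)%:E)%E).
  by rewrite esum_esum// => *; rewrite lee_fin box_volume_ge0.
apply: le_trans (epsilon_trick0 xpredT (ltW e0)).
rewrite nneseries_esumT; last first.
  by move=> n; rewrite lee_fin divr_ge0// ltW.
apply: le_esum => n _.
rewrite esum_fset; [|exact: finite_II|by move=> *; rewrite lee_fin box_volume_ge0].
rewrite -fsbig_ord sumEFin lee_fin; apply: le_trans (S2 n).
by rewrite (big_nth (0, 0)) big_mkord.
Qed.

End NullSets.

Section PositiveMeasure.
Variables (R : realType) (k : nat).

(** The volume of the box after lengthening each side by t. *)
Definition grown_volume (t : R) (a b : 'rV[R]_k) : R :=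
  \prod_(i < k) Num.max 0 (b 0 i - a 0 i + t).

Lemma continuous_prod (I : Type) (s : seq I) (F : I -> R -> R) x :
  (forall i, {for x, continuous (F i)}) ->
  {for x, continuous (fun t => \prod_(i <- s) F i t)}.
Proof.
move=> Fc; elim: s => [|i s IH].
  rewrite (_ : (fun t => _) = cst 1); first exact: cvg_cst.
  by apply/funext => t; rewrite big_nil.
rewrite (_ : (fun t => _) = (fun t => F i t * \prod_(j <- s) F j t)); last first.
  by apply/funext => t; rewrite big_cons.
by apply: cvgM; [exact: Fc|exact: IH].
Qed.

Lemma grown_volume_continuous a b : {for 0, continuous (fun t => grown_volume t a b)}.
Proof.
apply: continuous_prod => i.
apply: (@lipschitz_continuous R R R _ 1) => x y; rewrite mul1r.
rewrite ler_norml /Num.max; have := ler_norm (x - y).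
have := ler_norm (y - x); rewrite distrC => h1 h2.
by case: ifPn; case: ifPn; rewrite -?leNgt; lra.
Qed.

Lemma grown_volume_near a b (e : R) : 0 < e ->
  exists2 h, 0 < h & grown_volume h a b <= box_volume a b + e.
Proof.
move=> e0; have /cvgrPdist_le /(_ e e0) := @grown_volume_continuous a b.
move=> /nbhs_ballP[d /= d0 dH]; exists (d / 2); first by rewrite divr_gt0.
have /= := dH (d / 2); rewrite /ball/= sub0r normrN gtr0_norm ?divr_gt0// => h.
have {h} : `|grown_volume 0 a b - grown_volume (d / 2) a b| <= e by apply: h; lra.
have -> : grown_volume 0 a b = box_volume a b.
  by apply: eq_bigr => i _; rewrite addr0.
by rewrite ler_norml => /andP[]; lra.
Qed.

(** A segment of length l contains at most n l + 1 multiples of 1/n, none if l is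
    negative: n times the length lengthened by 1/n. *)
Lemma card_grid_segment (n : nat) (al be : R) : (0 < n)%N ->
  (#|[set z : 'I_n | al <= (z : nat)%:R / n%:R <= be]%SET|%:R : R) <=
  n%:R * Num.max 0 (be - al + n%:R^-1).
Proof.
move=> n0; have n0' : 0 < n%:R :> R by rewrite ltr0n.
set A := [set z | _]%SET.
have [->|[z1 z1A]] := finset.set_0Vmem A.
  by rewrite cards0 mulr_ge0// ?le_max ?lexx// ltW.
have [z0 z0A z0min] := @arg_minnP _ z1 (mem A) (fun z => z : nat) z1A.
have AP z : z \in A -> al <= (z : nat)%:R / n%:R /\ (z : nat)%:R / n%:R <= be.
  by rewrite finset.inE => /andP.
have [z0P _] := AP _ z0A.
have ab : 0 <= be - al.
  by have [h1 h2] := AP _ z1A; rewrite subr_ge0; exact: le_trans h1 h2.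
have nab : 0 <= n%:R * (be - al) by rewrite mulr_ge0// ltW.
pose w := Num.truncn (n%:R * (be - al)).
have zw z : z \in A -> (z - z0 <= w)%N.
  move=> zA; rewrite /w truncn_ge_nat// natrB ?z0min//.
  have [_ h] := AP _ zA; move: h z0P; rewrite ler_pdivrMr// ler_pdivlMr//; lra.
have : (#|A| <= w.+1)%N.
  rewrite -[leqRHS]card_ord -(@card_in_imset _ _ (fun z : 'I_n => inord (z - z0) : 'I_w.+1)).
    exact: max_card.
  move=> x y xA yA /(congr1 val); rewrite /= !inordK ?ltnS ?zw// => xy.
  by apply/val_inj => /=; rewrite -(subnK (z0min x xA)) xy subnK// z0min.
rewrite -(ler_nat R) => /le_trans; apply.
rewrite -natr1 (max_idPr _); last by rewrite addr_ge0 ?invr_ge0// ltW.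
by rewrite mulrDr divff ?gt_eqF// lerD2r truncn_le.
Qed.

Lemma card_grid_box (n : nat) (a b : 'rV[R]_k) : (0 < n)%N ->
  (#|[set z : {ffun 'I_k -> 'I_n} |
      [forall i, a 0%R i <= (z i : nat)%:R / n%:R <= b 0%R i]]%SET|%:R : R) <=
  n%:R ^+ k * grown_volume n%:R^-1 a b.
Proof.
move=> n0; rewrite /grown_volume -[in n%:R ^+ k](card_ord k) -prodr_const -big_split/=.
pose A i : {set 'I_n} := [set z : 'I_n | a 0%R i <= (z : nat)%:R / n%:R <= b 0%R i]%SET.
rewrite (_ : #|_| = (\prod_(i < k) #|A i|)%N); last first.
  have <- : #|family (fun i => mem (A i))| = (\prod_(i < k) #|A i|)%N.
    by rewrite card_family foldrE big_map big_enum.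
  apply: eq_card => z; rewrite finset.inE.
  by apply/forallP/familyP => h i; have := h i; rewrite finset.inE.
rewrite natr_prod; apply: ler_prod => i _; rewrite ler0n/=.
exact: card_grid_segment.
Qed.

Lemma open_coord_box (a b : 'rV[R]_k) : open [set x : 'rV[R]_k | forall i, a 0 i < x 0 i < b 0 i].
Proof.
rewrite openE => x xab.
suff : \forall y \near x, forall i, a 0 i < (y : 'rV[R]_k) 0 i < b 0 i by [].
have := @filter_forall 'rV[R]_k 'I_k (fun i (y : 'rV[R]_k) => a 0 i < y 0 i < b 0 i) (nbhs x) _.
apply => i; have /andP[ax xb] := xab i.
have xc : (fun y : 'rV[R]_k => y 0 i) @ x --> x 0 i by exact: coord_continuous.
have h1 : \forall y \near x, a 0 i < (y : 'rV[R]_k) 0 i := xc _ (lt_nbhsr ax).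
have h2 : \forall y \near x, (y : 'rV[R]_k) 0 i < b 0 i := xc _ (lt_nbhsl xb).
by near=> y; apply/andP; split; near: y.
Unshelve. all: by end_near. Qed.

(** Enlarge each box slightly, so that the interior of the enlarged box contains
    the box and the total volume grows by at most 1/2. The unit cube is compact,
    hence covered by finitely many enlarged boxes; these contain all n^k points of
    a fine grid, while each contains at most n^k times its volume, up to a further
    small enlargement. *)
Lemma unit_cube_cover (P : pred nat) (a b : nat -> 'rV[R]_k) :
  setT `<=` \bigcup_(m in [set m | P m]) box (a m) (b m) ->
  ((1 / 2)%:E <= \sum_(m <oo | P m) (box_volume (a m) (b m))%:E :> \bar R)%E.
Proof.
move=> cov; rewrite leNgt; apply/negP => lt2.
have e0 m : 0 < (2^-1 : R) / (2 ^ m.+1)%:R by rewrite divr_gt0// ltr0n expn_gt0.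
pose h m := projT1 (cid2 (grown_volume_near (a m) (b m) (e0 m))).
have h0 m : 0 < h m by rewrite /h; case: (cid2 _).
have hP m : grown_volume (h m) (a m) (b m) <= box_volume (a m) (b m) + 2^-1 / (2 ^ m.+1)%:R.
  by rewrite /h; case: (cid2 _).
(* A third of the allowed growth goes to each end of every side, and the last
   third pays for the grid mesh. *)
pose al m := a m - const_mx (h m / 3); pose be m := b m + const_mx (h m / 3).
have alE m i : al m 0 i = a m 0 i - h m / 3 by rewrite !mxE.
have beE m i : be m 0 i = b m 0 i + h m / 3 by rewrite !mxE.
pose Q : set 'rV[R]_k := [set v | forall i, v ord0 i \in `[(0 : R), (1 : R)]].
have : compact Q.
  apply: (@rV_compact _ _ (fun=> `[(0 : R), (1 : R)]%classic)).
  by move=> _; apply: segment_compact.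
rewrite compact_cover => /(_ nat [set m | P m] (fun m => [set x : 'rV[R]_k | forall i, al m 0 i < x 0 i < be m 0 i])).
case.
- by move=> m _; exact: open_coord_box.
- move=> x _; have [m Pm xm] := cov x Logic.I; exists m => // i.
  by have := xm i; rewrite alE beE; have := h0 m; lra.
move=> D DP Dcov.
have [n n0 nh] : exists2 n : nat, (0 < n)%N & forall m : nat, m \in D -> n%:R^-1 <= h m / 3.
  pose f m := Num.truncn (h m / 3)^-1.
  exists (\max_(m <- D) f m).+1 => // m mD.
  have h3 : 0 < h m / 3 by rewrite divr_gt0.
  rewrite invf_ple ?posrE ?ltr0n//; apply/ltW/(lt_le_trans (truncnS_gt _)).
  by rewrite ler_nat ltnS -/(f m); exact: (@leq_bigmax_seq _ _ xpredT f m).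
have n0' : 0 < n%:R :> R by rewrite ltr0n.
pose G m : {set {ffun 'I_k -> 'I_n}} := [set z : {ffun 'I_k -> 'I_n} |
      [forall i, al m 0%R i <= (z i : nat)%:R / n%:R <= be m 0%R i]]%SET.
have card1 : (n ^ k <= \sum_(m <- D) #|G m|)%N.
  have -> : (n ^ k)%N = #|{: {ffun 'I_k -> 'I_n}}| by rewrite card_ffun !card_ord.
  rewrite -sum1_card (eq_bigr (fun m => \sum_(z : {ffun 'I_k -> 'I_n}) (z \in G m : nat))%N); last first.
    by move=> m _; rewrite -sum1_card big_mkcond.
  rewrite exchange_big/=; apply: leq_sum => z _.
  have [|m /= mD zm] := Dcov (\row_i ((z i : nat)%:R / n%:R)).
    move=> i; rewrite mxE /= in_itv/= divr_ge0//= ler_pdivrMr// mul1r ler_nat.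
    exact: ltnW.
  rewrite (big_rem m)//= (_ : z \in G m) ?leq_addr//.
  rewrite finset.inE; apply/forallP => i.
  by have := zm i; rewrite mxE => /andP[/ltW -> /ltW ->].
have : (1 : R) <= \sum_(m <- D) (box_volume (a m) (b m) + 2^-1 / (2 ^ m.+1)%:R).
  apply: (@le_trans _ _ (\sum_(m <- D) grown_volume n%:R^-1 (al m) (be m))).
    rewrite -(ler_pM2l (exprn_gt0 k n0')) mulr1 mulr_sumr.
    move: card1; rewrite -(ler_nat R) natrX natr_sum => /le_trans; apply.
    by apply: ler_sum => m _; exact: card_grid_box.
  rewrite big_seq [leRHS]big_seq; apply: ler_sum => m mD; apply: le_trans (hP m).
  apply: ler_prod => i _; rewrite le_max lexx/= alE beE.
  rewrite ge_max le_max lexx/= le_max; apply/orP; right.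
  have := nh m mD; lra.
rewrite leNgt => /negP; apply.
have lee := @lee_sum_fset_lim R (fun m => (box_volume (a m) (b m))%:E + (2^-1 / (2 ^ m.+1)%:R)%:E)%E D P.
have Dsum : (\sum_(m <- D | P m) ((box_volume (a m) (b m))%:E + (2^-1 / (2 ^ m.+1)%:R)%:E) =
   (\sum_(m <- D) (box_volume (a m) (b m) + 2^-1 / (2 ^ m.+1)%:R))%:E)%E.
  rewrite -sumEFin big_seq_cond [RHS]big_seq_cond; apply: eq_big => m //.
  rewrite andbT; case: (boolP (m \in D)) => //= mD.
  by have := DP m mD; rewrite inE.
have ge0v m : (0 <= (box_volume (a m) (b m))%:E :> \bar R)%E by rewrite lee_fin box_volume_ge0.
rewrite -lte_fin -Dsum; apply: (le_lt_trans (lee _)).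
  by move=> m _; rewrite adde_ge0// lee_fin ltW.
have half0 : 0 <= 2^-1 :> R by rewrite invr_ge0.
apply: (le_lt_trans (epsilon_trick P ge0v half0)).
have -> : 1%:E = ((1 / 2)%:E + (2^-1)%:E : \bar R)%E.
  by rewrite -EFinD; congr EFin; lra.
by rewrite lteD2rE.
Qed.

Lemma lebesgue_outer_setT_neq0 : lebesgue_outer [set: 'rV[R]_k] != 0%E.
Proof.
apply: contraTneq (ltr01 : 0 < 1 :> R) => L0.
have : ((1 / 2)%:E <= lebesgue_outer [set: 'rV[R]_k])%E.
  apply: le_ereal_inf_tmp => _ [P [a [b [cov ->]]]].
  exact: unit_cube_cover.
by rewrite L0 lee_fin leNgt divr_gt0.
Qed.

End PositiveMeasure.

(** * Separable fields and their energy *)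

Section Clamp.
Variable R : realType.
Implicit Types r x y : R.

Definition clamp r x := Num.max (- r) (Num.min r x).

Lemma clamp_lip r x y : `|clamp r x - clamp r y| <= `|x - y|.
Proof.
have h1 := ler_norm (x - y); have := ler_norm (y - x); rewrite distrC => h2.
rewrite /clamp /Num.max /Num.min ler_norml.
by case: ifPn; case: ifPn; case: ifPn; case: ifPn; rewrite -?leNgt => *; lra.
Qed.

Lemma clamp_itv r x : 0 <= r -> - r <= clamp r x <= r.
Proof. by move=> r0; rewrite /clamp /Num.max /Num.min; do 2 case: ifPn; rewrite -?leNgt => *; lra. Qed.

Lemma clamp_id r x : `|x| <= r -> clamp r x = x.
Proof.
rewrite ler_norml => /andP[h1 h2]; apply/eqP; rewrite eq_le /clamp /Num.max /Num.min.
by do 2 case: ifPn; rewrite -?leNgt => *; lra.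
Qed.

Lemma clamp_homo r x y : x <= y -> clamp r x <= clamp r y.
Proof.
by move=> xy; rewrite /clamp /Num.max /Num.min; do 4 case: ifPn; rewrite -?leNgt => *; lra.
Qed.

End Clamp.

Section SeparableSystem.
Variables (R : realType) (k : nat) (J : 'M[R]_k) (phi : 'I_k -> R -> R).
Hypothesis J_antisym : forall i j, J i j = - J j i.

Definition separable_field (x : 'rV[R]_k) : 'rV[R]_k :=
  \row_i \sum_j J i j * phi j (x 0 j).

(** The diagonal of an antisymmetric matrix vanishes. *)
Lemma separable_field_indep (i : 'I_k) (x y : 'rV[R]_k) :
  (forall j, j != i -> x 0 j = y 0 j) ->
  separable_field x 0 i = separable_field y 0 i.
Proof.
move=> xy; rewrite !mxE; apply: eq_bigr => j _; have [->|/xy -> //] := eqVneq j i.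
have -> : J i i = 0 by have := J_antisym i i; lra.
by rewrite !mul0r.
Qed.

(** phi^T J phi = 0: the field is orthogonal to the gradient of the energy. *)
Lemma separable_field_power (x : 'rV[R]_k) :
  \sum_i phi i (x 0 i) * separable_field x 0 i = 0.
Proof.
set S := \sum_i _; suff : S = - S by lra.
have E : S = \sum_i \sum_j J i j * (phi i (x 0 i) * phi j (x 0 j)).
  apply: eq_bigr => i _; rewrite mxE mulr_sumr; apply: eq_bigr => j _; ring.
rewrite [LHS]E exchange_big/= E -sumrN; apply: eq_bigr => i _.
rewrite -sumrN; apply: eq_bigr => j _; rewrite J_antisym; ring.
Qed.

Lemma separable_energy_conserved (P : 'I_k -> R -> R) c (t : R) :
  (forall i (s : R), is_derive s 1 (P i) (phi i s)) ->
  solves separable_field c -> \sum_i P i (c t 0 i) = \sum_i P i (c 0 0 i).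
Proof.
move=> Pd cs; apply: (@is_derive_0_is_cst R (fun t => \sum_i P i (c t 0 i))) => s.
rewrite (_ : (fun t => _) = \sum_i (fun t : R => P i (c t 0 i))); last by rewrite fct_sumE.
rewrite -(separable_field_power (c s)); apply: is_derive_sum => i.
exact: (@is_derive1_comp R (P i) (fun s => c s 0 i)).
Qed.

Lemma separable_field_lip (K : 'I_k -> R) :
  (forall i, 0 <= K i) -> (forall i x y, `|phi i x - phi i y| <= K i * `|x - y|) ->
  exists2 L : R, 0 < L &
    forall x y, `|separable_field x - separable_field y| <= L * `|x - y|.
Proof.
move=> K0 Klip; exists (1 + \sum_i \sum_j `|J i j| * K j).
  by rewrite ltr_pwDl// sumr_ge0// => i _; rewrite sumr_ge0// => j _; rewrite mulr_ge0.
move=> x y; have S0 i : 0 <= \sum_j `|J i j| * K j.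
  by rewrite sumr_ge0// => j _; rewrite mulr_ge0.
apply: norm_rowB_le; first by rewrite mulr_ge0// addr_ge0// sumr_ge0.
move=> i; rewrite !mxE -sumrB.
apply: (@le_trans _ _ ((\sum_j `|J i j| * K j) * `|x - y|)); last first.
  by rewrite ler_wpM2r// [X in _ <= _ + X](bigD1 i)//= addrCA lerDl addr_ge0// sumr_ge0.
apply: le_trans (ler_norm_sum _ _ _) _; rewrite mulr_suml; apply: ler_sum => j _.
rewrite -mulrBr normrM -mulrA ler_wpM2l//; apply: le_trans (Klip _ _ _) _.
by rewrite ler_wpM2l// norm_coordB_le.
Qed.

Lemma separable_field_bnd (B : 'I_k -> R) :
  (forall i x, `|phi i x| <= B i) ->
  exists2 V : R, 0 <= V & forall x, `|separable_field x| <= V.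
Proof.
move=> Bb; have B0 i : 0 <= B i by apply: le_trans (normr_ge0 _) (Bb i 0).
have S0 i : 0 <= \sum_j `|J i j| * B j.
  by rewrite sumr_ge0// => j _; rewrite mulr_ge0.
exists (\sum_i \sum_j `|J i j| * B j); first by rewrite sumr_ge0.
move=> x; apply: norm_row_le; first by rewrite sumr_ge0.
move=> i; rewrite mxE; apply: (@le_trans _ _ (\sum_j `|J i j| * B j)).
  apply: le_trans (ler_norm_sum _ _ _) _; apply: ler_sum => j _.
  by rewrite normrM ler_wpM2l.
by rewrite [leRHS](bigD1 i)//= lerDl sumr_ge0.
Qed.

End SeparableSystem.

Section EnergyWell.
Variables (R : realType) (phi P : R -> R) (c : R).
Hypothesis phi_homo : {homo phi : x y / x <= y}.
Hypothesis phi_c : phi c = 0.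
Hypothesis P_deriv : forall t : R, is_derive t 1 P (phi t).

Lemma potential_right x y : c <= x -> x <= y -> P x <= P y.
Proof.
move=> cx xy; apply: (@deriv_ge0_le R P phi) => // t /andP[xt _].
by rewrite -phi_c; apply: phi_homo; exact: le_trans xt.
Qed.

Lemma potential_left x y : y <= c -> x <= y -> P y <= P x.
Proof.
move=> yc xy; rewrite -lerN2.
apply: (@deriv_ge0_le R (- P) (fun t => - phi t)) => // t /andP[_ ty].
by rewrite oppr_ge0 -phi_c; apply: phi_homo; exact: le_trans yc.
Qed.

Lemma potential_min x : P c <= P x.
Proof. by case: (leP c x) => cx; [exact: potential_right|apply: potential_left => //; exact: ltW]. Qed.

End EnergyWell.

(** What the lattice argument needs of a field. The last clause, independence of
    the i-th component from the i-th coordinate, is a strong form of divergence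
    zero. *)
Definition tame_field (R : realType) (k : nat) (w : 'rV[R]_k -> 'rV[R]_k) :=
  exists L V : R, [/\ 0 <= L, 0 <= V, forall x y, `|w x - w y| <= L * `|x - y|,
    forall x, `|w x| <= V
    & forall (i : 'I_k) (x y : 'rV[R]_k),
        (forall j, j != i -> x 0 j = y 0 j) -> w x 0 i = w y 0 i].

(** * The flow of a separable field *)

Section SeparableFlow.
Variables (R : realType) (k : nat) (J : 'M[R]_k) (phi : 'I_k -> R -> R).
Variable c : 'I_k -> R.
Hypothesis J_antisym : forall i j, J i j = - J j i.
Hypothesis phi_incr : forall i, {homo phi i : x y / x < y}.
Hypothesis phi_c : forall i, phi i (c i) = 0.
Hypothesis phi_lip : forall i (r : R), exists2 K : R, 0 <= K &
  forall x y, `|x| <= r -> `|y| <= r -> `|phi i x - phi i y| <= K * `|x - y|.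

Let v := separable_field J phi.

Let phi_homo i : {homo phi i : x y / x <= y}.
Proof. by move=> x y; rewrite le_eqVlt => /predU1P[->//|/(phi_incr i)/ltW]. Qed.

Let phi_clamp (r : R) i (x : R) := phi i (clamp r x).
Let vr (r : R) := separable_field J (phi_clamp r).

Let phi_clamp_homo r i : {homo phi_clamp r i : x y / x <= y}.
Proof. by move=> x y xy; apply: phi_homo; exact: clamp_homo. Qed.

Let clamp_norm (r x : R) : 0 <= r -> `|clamp r x| <= r.
Proof. by move=> r0; rewrite ler_norml clamp_itv. Qed.

Let phi_clamp_lip r i : 0 <= r -> exists2 K : R, 0 <= K &
  forall x y, `|phi_clamp r i x - phi_clamp r i y| <= K * `|x - y|.
Proof.
move=> r0; have [K K0 HK] := phi_lip i r; exists K => // x y.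
apply: le_trans (HK _ _ _ _) _; rewrite ?clamp_norm//.
by rewrite ler_wpM2l// clamp_lip.
Qed.

Let phi_clamp_bnd r i x : 0 <= r -> `|phi_clamp r i x| <= `|phi i r| + `|phi i (- r)|.
Proof.
move=> r0; have /andP[h1 h2] := clamp_itv x r0.
have := phi_homo i h1; have := phi_homo i h2; rewrite -/(phi_clamp r i x).
have := ler_norm (phi i r); have := ler_norm (- phi i (- r)); rewrite normrN.
have := normr_ge0 (phi i r); have := normr_ge0 (phi i (- r)).
by move=> *; rewrite ler_norml; lra.
Qed.

Let phi_continuous i : continuous (phi i).
Proof.
move=> x; have [K K0 HK] := phi_lip i (`|x| + 1).
apply/cvgrPdist_lt => e e0; near=> y.
have xy : `|x - y| < e / (K + 1).
  by near: y; apply: cvgr_dist_lt => //; rewrite divr_gt0// ltr_wpDl.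
have xy1 : `|x - y| < 1 by near: y; apply: cvgr_dist_lt.
apply: le_lt_trans (HK _ _ _ _) _; first by rewrite lerDl.
  by have := ler_normB x (x - y); rewrite subKr; lra.
rewrite (@le_lt_trans _ _ ((K + 1) * `|x - y|))//.
  by rewrite ler_wpM2r// lerDl.
by rewrite mulrC -ltr_pdivlMr// ltr_wpDl.
Unshelve. all: by end_near. Qed.

(** Normalized so that its minimum, attained at c_i, is 0. *)
Definition well i (x : R) := primitive (phi i) x - primitive (phi i) (c i).

Let well_deriv i (t : R) : is_derive t 1 (well i) (phi i t).
Proof.
have [_ h] := primitiveP (@phi_continuous i).
rewrite /well; have := @is_deriveDcst R _ (- primitive (phi i) (c i)) _ _ (h t).
by under [X in is_derive _ _ X _ -> _]eq_fun do rewrite addrC.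
Qed.

Let well_c i : well i (c i) = 0. Proof. by rewrite /well subrr. Qed.

Let well_ge0 i x : 0 <= well i x.
Proof. by rewrite -(well_c i); exact: (potential_min (@phi_homo i) (phi_c i) (well_deriv i)). Qed.

Definition energy (x : 'rV[R]_k) := \sum_i well i (x 0 i).

Let well_le_energy (x : 'rV[R]_k) i : well i (x 0 i) <= energy x.
Proof. by rewrite /energy (bigD1 i)//= lerDl sumr_ge0. Qed.

(** Every well is higher than h at both ends of [- r, r]; the wells being monotone
    on either side of c_i, a point of energy at most h lies in the cube of radius
    r. *)
Definition confining (r h : R) :=
  0 <= r /\ forall i, [/\ `|c i| <= r, h < well i r & h < well i (- r)].

Let well_coercive i h : exists2 r, `|c i| <= r & h < well i r /\ h < well i (- r).
Proof.
have p1 : 0 < phi i (c i + 1) by rewrite -(phi_c i) phi_incr// ltrDl.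
have p2 : phi i (c i - 1) < 0 by rewrite -[ltRHS](phi_c i) phi_incr// gtrDl ltrN10.
(* Beyond distance 1 from c_i, the well has slope at least q in absolute value. *)
pose q := Num.min (phi i (c i + 1)) (- phi i (c i - 1)).
have q0 : 0 < q by rewrite lt_min p1 oppr_gt0.
have qr : q <= phi i (c i + 1) by rewrite ge_min lexx.
have ql : q <= - phi i (c i - 1) by rewrite ge_min lexx orbT.
have right x : c i + 1 <= x -> q * (x - c i - 1) <= well i x.
  move=> cx; have := @deriv_le_le R ( *%R q) (well i) (fun=> q) (phi i) _ _ cx.
  move=> /(_ (fun t _ => is_derive_mull q t) (fun t _ => well_deriv i t)) H.
  have {}H : q * x - q * (c i + 1) <= well i x - well i (c i + 1).
    by apply: H => t /andP[ct _]; apply: le_trans qr _; apply: phi_homo.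
  have := well_ge0 i (c i + 1); rewrite -addrA -opprD mulrBr; lra.
have left x : x <= c i - 1 -> q * (c i - 1 - x) <= well i x.
  move=> cx; have := @deriv_le_le R (well i) ( *%R (- q)) (phi i) (fun=> - q) _ _ cx.
  move=> /(_ (fun t _ => well_deriv i t) (fun t _ => is_derive_mull (- q) t)) H.
  have {}H : well i (c i - 1) - well i x <= - q * (c i - 1) - - q * x.
    by apply: H => t /andP[_ ct]; rewrite lerNr; apply: le_trans ql _; rewrite lerN2; apply: phi_homo.
  have := well_ge0 i (c i - 1); rewrite mulrBr; lra.
pose r := `|c i| + 1 + (`|h| + 1) / q.
have hq : 0 <= (`|h| + 1) / q by rewrite divr_ge0 ?addr_ge0// ltW.
have hn : h <= `|h| := ler_norm h.
have cn : c i <= `|c i| := ler_norm _.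
have cn' : - c i <= `|c i| by rewrite -normrN ler_norm.
exists r; first by rewrite /r; lra.
have main y : (`|h| + 1) / q <= y -> h < q * y.
  by move=> hy; have := ler_wpM2l (ltW q0) hy; rewrite mulrC divfK ?gt_eqF//; lra.
split.
  by apply: lt_le_trans (right r _); [apply: main|]; rewrite /r; lra.
by apply: lt_le_trans (left (- r) _); [apply: main|]; rewrite /r; lra.
Qed.

Let well_right i x y : c i <= x -> x <= y -> well i x <= well i y.
Proof. exact: (potential_right (@phi_homo i) (phi_c i) (well_deriv i)). Qed.

Let well_left i x y : y <= c i -> x <= y -> well i y <= well i x.
Proof. exact: (potential_left (@phi_homo i) (phi_c i) (well_deriv i)). Qed.

Lemma confining_exists h : exists r, confining r h.
Proof.
pose r i := sval (cid2 (well_coercive i h)).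
have rP i : [/\ `|c i| <= r i, h < well i (r i) & h < well i (- r i)].
  by rewrite /r; case: (cid2 _) => /= x ? [? ?].
have r0 i : 0 <= r i by have [h1 _ _] := rP i; exact: le_trans (normr_ge0 _) h1.
exists (\sum_i r i); split; first by rewrite sumr_ge0.
move=> i; have [h1 h2 h3] := rP i.
have ri : r i <= \sum_i r i by rewrite (bigD1 i)//= lerDl sumr_ge0.
move: (h1); rewrite ler_norml => /andP[c1 c2].
split; first exact: le_trans ri.
  exact: lt_le_trans (well_right c2 ri).
by apply: lt_le_trans h3 _; apply: well_left; rewrite ?lerN2//.
Qed.

Lemma confining_bound r h x : confining r h -> energy x <= h -> forall i, `|x 0 i| <= r.
Proof.
move=> [r0 rP] xh i; have [h1 h2 h3] := rP i.
move: (h1); rewrite ler_norml => /andP[c1 c2].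
have wx := le_trans (well_le_energy x i) xh.
rewrite ler_norml; apply/andP; split; rewrite leNgt; apply/negP => xr.
  have := @well_left i (x 0 i) (- r) c1 (ltW xr); lra.
have := @well_right i r (x 0 i) c2 (ltW xr); lra.
Qed.

Lemma energy_continuous : continuous energy.
Proof.
move=> x; rewrite /energy; elim: (index_enum _) => [|i s IH].
  have -> : (fun y : 'rV[R]_k => \sum_(i <- [::]) well i (y 0 i)) = cst 0.
    by apply/funext => y; rewrite big_nil.
  exact: cst_continuous.
have -> : (fun y : 'rV[R]_k => \sum_(j <- i :: s) well j (y 0 j)) =
    (fun y : 'rV[R]_k => well i (y 0 i) + \sum_(j <- s) well j (y 0 j)).
  by apply/funext => y; rewrite big_cons.
have wc : {for x, continuous (fun y : 'rV[R]_k => well i (y 0 i))}.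
  apply: (@continuous_comp _ _ _ (fun y : 'rV[R]_k => y 0 i) (well i)).
    exact: coord_continuous.
  exact: is_derive_continuous (well_deriv i _).
exact: (continuousD wc IH).
Qed.

Section Clamped.
Variables (r h : R).
Hypothesis rh : confining r h.
Let r0 : 0 <= r. Proof. by case: rh. Qed.

Let well_r i (x : R) := primitive (phi_clamp r i) x - primitive (phi_clamp r i) (c i).

Let well_r_deriv i (t : R) : is_derive t 1 (well_r i) (phi_clamp r i t).
Proof.
have [K K0 HK] := phi_clamp_lip i r0.
have [_ H] := primitiveP (@lipschitz_continuous R R R _ K HK).
rewrite /well; have := @is_deriveDcst R _ (- primitive (phi_clamp r i) (c i)) _ _ (H t).
by under [X in is_derive _ _ X _ -> _]eq_fun do rewrite addrC.
Qed.

Let c_bnd i : `|c i| <= r. Proof. by have [? _ _] := rh.2 i. Qed.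

Let phi_clamp_c i : phi_clamp r i (c i) = 0.
Proof. by rewrite /phi_clamp clamp_id. Qed.

Let well_rE i x : `|x| <= r -> well_r i x = well i x.
Proof.
move=> xr; have D (t : R) : `|t| <= r -> is_derive t 1 (well_r i - well i) 0.
  move=> tr; have -> : 0 = phi_clamp r i t - phi i t by rewrite /phi_clamp clamp_id// subrr.
  exact: is_deriveB.
have E (a b : R) : `|a| <= r -> `|b| <= r -> a <= b -> (well_r i - well i) a = (well_r i - well i) b.
  rewrite !ler_norml => /andP[a1 a2] /andP[b1 b2] ab.
  have tr (t : R) : a <= t <= b -> `|t| <= r by rewrite ler_norml; lra.
  have H1 := @deriv_ge0_le R (well_r i - well i) (fun=> 0) a b ab.
  have H2 := @deriv_ge0_le R (- (well_r i - well i)) (fun=> - 0) a b ab.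
  apply/eqP; rewrite eq_le; apply/andP; split.
    by apply: H1 => // t /tr /D.
  rewrite -lerN2; apply: H2 => [t /tr /D ?|]; first exact: is_deriveN.
  by rewrite oppr0.
have {}E : (well_r i - well i) x = (well_r i - well i) (c i).
  by case: (leP x (c i)) => xc; [|symmetry]; apply: E => //; exact: ltW.
by move: E; rewrite !fctE /well_r /well !subrr => /subr0_eq.
Qed.

(** The wells of the clamped field agree with the original ones on [- r, r] and are
    monotone beyond. So they too exceed h outside the cube, which the conserved
    clamped energy then prevents the orbit from leaving; inside the cube the two
    energies coincide. *)
Lemma clamped_confined c' : solves (vr r) c' -> energy (c' 0) <= h ->
  forall t, energy (c' t) = energy (c' 0) /\ forall i, `|c' t 0 i| <= r.
Proof.
move=> cs ch t; have E := separable_energy_conserved J_antisym t well_r_deriv cs.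
have b0 := confining_bound rh ch.
have E0 : \sum_i well_r i (c' 0 0 i) = energy (c' 0).
  by apply: eq_bigr => i _; apply: well_rE.
have wc i x : 0 <= well_r i x.
  have <- : well_r i (c i) = 0 by rewrite /well_r subrr.
  exact: (potential_min (@phi_clamp_homo r i) (phi_clamp_c i) (well_r_deriv i)).
have bt i : `|c' t 0 i| <= r.
  have wx : well_r i (c' t 0 i) <= h.
    rewrite (le_trans _ ch)// -E0 -E (bigD1 i)//= lerDl sumr_ge0//.
  have [h1 h2 h3] := rh.2 i; move: (h1); rewrite ler_norml => /andP[c1 c2].
  rewrite ler_norml; apply/andP; split; rewrite leNgt; apply/negP => xr.
    have := potential_left (@phi_clamp_homo r i) (phi_clamp_c i) (well_r_deriv i) c1 (ltW xr).
    rewrite [well_r i (- r)]well_rE ?normrN ?ger0_norm//; lra.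
  have := potential_right (@phi_clamp_homo r i) (phi_clamp_c i) (well_r_deriv i) c2 (ltW xr).
  rewrite [well_r i r]well_rE ?ger0_norm//; lra.
split=> //; rewrite -E0 -E; apply: eq_bigr => i _; by rewrite well_rE.
Qed.

Lemma clamped_field_eq (x : 'rV[R]_k) : (forall i, `|x 0 i| <= r) -> vr r x = v x.
Proof.
move=> xr; apply/rowP => i; rewrite !mxE; apply: eq_bigr => j _.
by rewrite /phi_clamp clamp_id.
Qed.

Lemma clamped_field_lip : exists2 L : R, 0 < L &
  forall x y, `|vr r x - vr r y| <= L * `|x - y|.
Proof.
apply: (separable_field_lip J (K := fun i => s2val (cid2 (phi_clamp_lip i r0)))) => i; by case: cid2.
Qed.

Lemma clamped_field_bnd : exists2 V : R, 0 <= V & forall x, `|vr r x| <= V.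
Proof.
by apply: (separable_field_bnd J (B := fun i => `|phi i r| + `|phi i (- r)|)) => i x; exact: phi_clamp_bnd.
Qed.

End Clamped.

Let rad h := sval (cid (confining_exists h)).

Let radP h : confining (rad h) h.
Proof. by rewrite /rad; case: cid. Qed.

Let clamped_flow h : exists Phi : R -> 'rV[R]_k -> 'rV[R]_k,
  (forall x, Phi 0 x = x) /\ forall x, solves (vr (rad h)) (Phi^~ x).
Proof.
have [L L0 HL] := clamped_field_lip (radP h).
have [V V0 HV] := clamped_field_bnd (radP h).
exact: lipschitz_flow_exists L0 V0 HL HV.
Qed.

Let Phi h := sval (cid (clamped_flow h)).

Let Phi0 h x : Phi h 0 x = x.
Proof. by rewrite /Phi; case: cid => F [/= ? ?]. Qed.

Let Phi_solves h x : solves (vr (rad h)) (Phi h ^~ x).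
Proof. by rewrite /Phi; case: cid => F [/= ? ?]. Qed.

Let Phi_confined h x t : energy x <= h -> energy (Phi h t x) = energy x.
Proof.
move=> xh; have [|-> _] := clamped_confined (radP h) (@Phi_solves h x) _ t; by rewrite Phi0.
Qed.

Let Phi_bounded h x t i : energy x <= h -> `|Phi h t x 0 i| <= rad h.
Proof.
by move=> xh; have [|_ ->] := clamped_confined (radP h) (@Phi_solves h x) _ t; rewrite ?Phi0.
Qed.

Let solves_eq (w w' : 'rV[R]_k -> 'rV[R]_k) d : (forall t, w (d t) = w' (d t)) ->
  solves w d -> solves w' d.
Proof. by move=> ww ds i t; rewrite -ww; exact: ds. Qed.

Let Phi_solves_v h x : energy x <= h -> solves v (Phi h ^~ x).
Proof.
move=> xh; apply: solves_eq (Phi_solves h x) => t.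
by apply: clamped_field_eq => i; exact: Phi_bounded.
Qed.

Let Phi_unique h d t : solves v d -> energy (d 0) <= h ->
  (forall s, energy (d s) <= h) -> d t = Phi h t (d 0).
Proof.
move=> dv d0 dh; have [L L0 HL] := clamped_field_lip (radP h).
apply: (@solution_unique _ _ _ _ (ltW L0) HL d (Phi h ^~ (d 0))); rewrite ?Phi0//.
apply: solves_eq dv => s; rewrite clamped_field_eq// => i.
exact: (confining_bound (radP h)).
Qed.

(** Below energy h, the original flow is the flow Phi h of the clamped field; the
    initial energy is the smallest admissible h for the orbit of x. *)
Definition separable_flow t x := Phi (energy x) t x.

(* The flow near x is computed with a single clamped field, for any h above the
   energy of x. *)
Let flow_local h x t : energy x <= h -> separable_flow t x = Phi h t x.
Proof.
move=> xh; have E := @Phi_unique h (Phi (energy x) ^~ x) t.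
move: E; rewrite Phi0; apply => //; first exact: Phi_solves_v.
by move=> s; rewrite Phi_confined.
Qed.

Lemma separable_flow_solves x : solves v (separable_flow ^~ x).
Proof. exact: Phi_solves_v. Qed.

Lemma separable_flow0 x : separable_flow 0 x = x.
Proof. exact: Phi0. Qed.

Lemma separable_flow_energy t x : energy (separable_flow t x) = energy x.
Proof. exact: Phi_confined. Qed.

Lemma separable_flowD s t x :
  separable_flow (s + t) x = separable_flow s (separable_flow t x).
Proof.
rewrite [RHS](@flow_local (energy x)) ?separable_flow_energy//.
have := @Phi_unique (energy x) (fun s => separable_flow (s + t) x) s.
rewrite add0r; apply.
- exact: (solves_shift _ (separable_flow_solves x)).
- by rewrite separable_flow_energy.
- by move=> u; rewrite separable_flow_energy.
Qed.

(** Near (t, x) the energy stays below energy x + 1, so that the flow is that of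
    one bounded Lipschitz field, which is Lipschitz in time and in the initial
    point. *)
Lemma separable_flow_continuous : continuous (fun tx : R * 'rV[R]_k => separable_flow tx.1 tx.2).
Proof.
move=> [t x]; pose h := energy x + 1.
have [L L0 HL] := clamped_field_lip (radP h).
have [V V0 HV] := clamped_field_bnd (radP h).
pose M := 1 + k%:R * expR (2 * k%:R * L * (`|t| + 1)).
have M0 : 0 < M by rewrite ltr_pwDl// mulr_ge0// expR_ge0.
have lipx s y : `|s| <= `|t| + 1 -> `|Phi h s y - Phi h s x| <= M * `|y - x|.
  move=> st; have := solution_dependence (ltW L0) HL s (@Phi_solves h y) (@Phi_solves h x).
  rewrite !Phi0 => H.
  rewrite -ler_sqr ?nnegrE ?mulr_ge0 ?(ltW M0)//; apply: le_trans H _.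
  rewrite exprMn mulrAC; apply: ler_wpM2r; first exact: sqr_ge0.
  have M1 : 1 <= M by rewrite lerDl mulr_ge0// expR_ge0.
  apply: (@le_trans _ _ M); last by rewrite expr2 ler_peMl// ltW.
  rewrite /M (@le_trans _ _ (k%:R * expR (2 * k%:R * L * (`|t| + 1))))//; last by rewrite lerDr.
  by rewrite ler_wpM2l// ler_expR ler_wpM2l// !mulr_ge0// ltW.
have lipt s : `|Phi h s x - Phi h t x| <= V * `|s - t|.
  exact: (solution_lipschitz _ _ HV (@Phi_solves h x)).
apply/cvgrPdist_lt => e e0 /=.
have hx : energy x < h by rewrite ltrDl.
have c1 : (fun p : R * 'rV[R]_k => p.1) @ (t, x) --> t by exact: cvg_fst.
have c2 : (fun p : R * 'rV[R]_k => p.2) @ (t, x) --> x by exact: cvg_snd.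
have ec : {for (t, x), continuous (energy \o @snd R 'rV[R]_k)}.
  by apply: continuous_comp; [exact: cvg_snd|exact: energy_continuous].
have nE : \forall p \near (t, x), energy p.2 < h := ec _ (lt_nbhsl hx).
have e1 : 0 < Num.min 1 (e / 2 / (V + 1)).
  by rewrite lt_min ltr01/= !divr_gt0// ltr_wpDl.
have e2 : 0 < e / 2 / M by rewrite !divr_gt0.
have n1 : \forall p \near (t, x), `|t - p.1| < Num.min 1 (e / 2 / (V + 1)).
  by have /cvgrPdist_lt /(_ _ e1) := c1.
have n2 : \forall p \near (t, x), `|x - p.2| < e / 2 / M.
  by have /cvgrPdist_lt /(_ _ e2) := c2.
near=> p.
have p1 : `|p.1 - t| < Num.min 1 (e / 2 / (V + 1)).
  by rewrite distrC; near: p.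
have p2 : `|p.2 - x| < e / 2 / M.
  by rewrite distrC; near: p.
have pE : energy p.2 < h by near: p.
rewrite (@flow_local h) ?(ltW hx)// (@flow_local h) ?(ltW pE)// distrC.
have := ler_distD (Phi h p.1 x) (Phi h p.1 p.2) (Phi h t x).
have := lipt p.1.
have : `|p.1| <= `|t| + 1.
  have := ler_normD (p.1 - t) t; rewrite subrK; move: p1; rewrite lt_min => /andP[]; lra.
move=> /(lipx _ p.2).
have : M * `|p.2 - x| < e / 2 by rewrite mulrC -ltr_pdivlMr.
have : V * `|p.1 - t| <= e / 2.
  move: p1; rewrite lt_min => /andP[_]; rewrite ltr_pdivlMr ?ltr_wpDl// => H.
  apply: le_trans (ltW H); rewrite mulrC ler_wpM2l// lerDl//.
lra.
Unshelve. all: by end_near. Qed.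

Lemma separable_flow_tame h : exists w, tame_field w /\
  exists r : R, forall x, energy x <= h -> solves w (separable_flow ^~ x) /\
    forall t, `|separable_flow t x| <= r.
Proof.
have [L L0 HL] := clamped_field_lip (radP h).
have [V V0 HV] := clamped_field_bnd (radP h).
exists (vr (rad h)); split.
  exists L, V; split=> //; first exact: ltW.
  by move=> i x y; exact: separable_field_indep.
exists (rad h) => x xh; split.
  by move=> i t; under [X in is_derive _ _ X _]eq_fun do rewrite (flow_local _ xh);
    rewrite (flow_local _ xh); exact: Phi_solves.
move=> t; apply: norm_row_le; first by case: (radP h).
by move=> i; rewrite (flow_local _ xh) Phi_bounded.
Qed.

End SeparableFlow.

(** * Recurrence *)

Section Recurrence.
Variables (R : realType) (k : nat) (Psi : R -> 'rV[R]_k -> 'rV[R]_k).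
Variable en : 'rV[R]_k -> R.
Hypothesis Psi_flow : is_flow setT Psi.
Hypothesis Psi_tame : forall h, exists w, tame_field w /\
  exists r : R, forall x, en x <= h -> solves w (Psi ^~ x) /\
    forall t, `|Psi t x| <= r.

(** The gap between the radii 1/(m+1) and 2/(m+1) leaves room for the lattice
    approximation, the energy bound h keeps the orbits in a cube, and the
    parameters range over a countable set. *)
Definition wandering (a : 'rV[int]_k) (m h n : nat) : set 'rV[R]_k :=
  [set x | [/\ en x <= h%:R, `|x - lattice_pt R m.+1 a| <= m.+1%:R^-1
    & forall j, (0 < j)%N -> 2 / m.+1%:R <= `|Psi (n%:R *+ j) x - lattice_pt R m.+1 a|]].

(** With an error q/3 of the lattice map and a mesh at most q/3, where q = 1/(m+1),
    a return of a lattice point near the set would bring an orbit within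
    q/3 + q/3 + q < 2 q of a. *)
Lemma wandering_null a m h n : jordan_null (wandering a m h n).
Proof.
move=> e e0.
have [w [[L [V [L0 V0 wlip wbnd windep]]] [r rP]]] := Psi_tame h%:R.
pose C := (Num.truncn `|r|).+2.
have rC : r + 1 <= C%:R.
  rewrite /C -natr1 lerD2r; apply: le_trans (ler_norm _) _.
  by apply: ltW; exact: truncnS_gt.
have [J J0 HJ] := @exists_large_nat R ((2 * C + 1)%:R ^+ k) e e0.
have [q qE] : exists q : R, q = m.+1%:R^-1 by exists m.+1%:R^-1.
have m0 : 0 < q by rewrite qE invr_gt0.
have d0 : 0 < q / 3 by rewrite divr_gt0.
have [p [sg [p0 pd sginj sgP]]] :=
  lattice_flow_approx L0 V0 wlip wbnd windep J (ler0n R n) d0.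
have d1 : q / 3 <= 1.
  have : q <= 1 by rewrite qE invf_le1 ?ltr0n// ler1n.
  lra.
have follow z x j : wandering a m h n x -> `|lattice_pt R p z - x| <= p%:R^-1 -> (j <= J)%N ->
    `|lattice_pt R p (iter j sg z) - Psi (n%:R *+ j) x| <= q / 3.
  move=> [xh _ _] zx jJ; have [xs _] := rP x xh.
  by apply: (sgP (Psi ^~ x)) => //; have [_ -> //] := Psi_flow.
have [||s [s1 s2]] := @return_cover R k (wandering a m h n) C p J sg p0 J0 sginj.
- move=> z j [x xw zx] jJ; have f := follow z x j xw zx (ltnW jJ).
  have [xh _ _] := xw; have [_ /(_ (n%:R *+ j)) xr] := rP x xh.
  have := ler_normD (lattice_pt R p (iter j sg z) - Psi (n%:R *+ j) x) (Psi (n%:R *+ j) x).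
  rewrite subrK; lra.
- move=> z j [x xw zx] /andP[j0 jJ] [y [_ ya _] zy].
  have f := follow z x j xw zx (ltnW jJ).
  have [_ _ /(_ j j0)] := xw; apply/negP; rewrite -ltNge.
  have t1 := ler_distD (lattice_pt R p (iter j sg z)) (Psi (n%:R *+ j) x) (lattice_pt R m.+1 a).
  have t2 := ler_distD y (lattice_pt R p (iter j sg z)) (lattice_pt R m.+1 a).
  rewrite [X in _ <= X + _]distrC in t1.
  rewrite -!qE in ya *; lra.
by exists s; split=> //; exact: le_trans HJ.
Qed.

(** Returns at arbitrarily late times are chosen one after the other, each one
    later than the integer following the previous one. *)
Lemma late_returns_recurrent x :
  (forall W, nbhs x W -> forall n : nat, exists2 t : R, n%:R <= t & W (Psi t x)) ->
  recurrent Psi x.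
Proof.
move=> H W xW.
pose g n := sval (cid2 (H W xW n)).
have gP n : n%:R <= g n /\ W (Psi (g n) x) by rewrite /g; case: cid2.
pose t := fix t i := if i is i'.+1 then g (Num.truncn `|t i'|).+1 else g 0%N : R.
have tS i : t i < t i.+1.
  apply: le_lt_trans (ler_norm _) _; apply: lt_le_trans (gP _).1.
  exact: truncnS_gt.
have ti : increasing_seq t by apply/increasing_seqP.
have tge i : i%:R <= t i.
  elim: i => [|i IH]; first exact: (gP 0%N).1.
  apply: le_trans (gP _).1; rewrite ler_nat ltnS truncn_ge_nat//.
  exact: le_trans (ler_norm _).
exists t; split=> //; last by case=> [|i]; exact: (gP _).2.
apply/cvgryPge => A; near=> i; apply: le_trans (tge i).
by near: i; exact: nbhs_infty_ger.
Unshelve. all: by end_near. Qed.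

(** A neighbourhood W of x is never visited after some time n. Take a grid so fine
    that W contains the ball of radius 3/(m+1) around x; an orbit
    within 2/(m+1) of the lattice point next to x is then in W. *)
Lemma nonrecurrent_wandering x : ~ recurrent Psi x ->
  exists a m h n, wandering a m h n x.
Proof.
move=> nr.
have [W xW [n Wn]] : exists2 W, nbhs x W & exists n : nat, forall t : R, n%:R <= t -> ~ W (Psi t x).
  apply: contrapT => H; apply: nr; apply: late_returns_recurrent => W xW n.
  apply: contrapT => H2; apply: H; exists W => //; exists n => t nt Wt.
  by apply: H2; exists t.
have /nbhs_ballP[e /= e0 eW] := xW.
have [m1 m10 m1e] := @exists_large_nat R 3 (e / 2) (divr_gt0 e0 (ltr0Sn R 1)).
case: m1 m10 m1e => [//|m] _ me.
have [c1 _] := floor_cell x (ltn0Sn m).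
exists (\row_i Num.floor (m.+1%:R * x 0 i)), m, (Num.truncn `|en x|).+1, n; split.
- by apply: ltW; apply: le_lt_trans (ler_norm _) _; exact: truncnS_gt.
- by rewrite distrC.
move=> j j0; rewrite leNgt; apply/negP => lt2.
apply: (Wn (n%:R *+ j)); first by rewrite -mulrnA ler_nat leq_pmulr.
apply: eW; rewrite -ball_normE /=.
set a := lattice_pt _ _ _ in c1 lt2.
have := ler_distD a x (Psi (n%:R *+ j) x).
rewrite (distrC a (Psi _ _)) (distrC x a).
have : 0 < m.+1%:R^-1 :> R by rewrite invr_gt0.
by move: (m.+1%:R^-1) c1 me lt2 => q *; lra.
Qed.

Lemma tame_flow_recurrent : poincare_recurrent setT Psi.
Proof.
split=> //; first exact: lebesgue_outer_setT_neq0.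
pose E (i : nat) := if (unpickle i : option ('rV[int]_k * nat * nat * nat)) is Some (a, m, h, n)
  then wandering a m h n else set0.
apply: (@lebesgue_outer_null R k E).
  move=> i; rewrite /E; case: unpickle => [[[[a m] h] n]|]; first exact: wandering_null.
  by move=> e e0; exists [::]; split=> //; rewrite big_nil ltW.
move=> x [_ /nonrecurrent_wandering[a [m [h [n xw]]]]].
by exists (pickle (a, m, h, n)); [exact: Logic.I|rewrite /E pickleK; exact: xw].
Qed.

End Recurrence.

(** Only local Lipschitz continuity of phi is asked; the zeros c_i make the
    wells bounded below and coercive. *)
Theorem separable_flow_recurrent (R : realType) (k : nat) (J : 'M[R]_k)
    (phi : 'I_k -> R -> R) (c : 'I_k -> R) :
  (forall i j, J i j = - J j i) ->
  (forall i, {homo phi i : x y / x < y}) ->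
  (forall i, phi i (c i) = 0) ->
  (forall i (r : R), exists2 K : R, 0 <= K &
    forall x y, `|x| <= r -> `|y| <= r -> `|phi i x - phi i y| <= K * `|x - y|) ->
  exists Psi : R -> 'rV[R]_k -> 'rV[R]_k,
  [/\ forall x, solves (separable_field J phi) (Psi ^~ x),
      continuous (fun tx : R * 'rV[R]_k => Psi tx.1 tx.2)
    & poincare_recurrent setT Psi].
Proof.
move=> Ja pi pc pl.
exists (separable_flow J pi pc pl).
have fc : continuous (fun tx : R * 'rV[R]_k => separable_flow J pi pc pl tx.1 tx.2).
  exact: separable_flow_continuous.
split=> //; first exact: separable_flow_solves.
apply: (@tame_flow_recurrent _ _ _ (energy phi c)); last exact: separable_flow_tame.
split=> //.
- by move=> x _; exact: separable_flow0.
- by move=> s t x _; exact: separable_flowD.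
- exact: continuous_subspaceT.
Qed.

(** * Calculus of C^k maps on open sets *)

Section NearDifferentiable.
Variables (R : realType) (V W : normedModType R).

Lemma near0_differentiable (e : V -> W) x :
  (\forall y \near x, e y = 0) -> differentiable e x.
Proof.
move=> e0; have ex : e x = 0 by exact: (nbhs_singleton e0).
have eo : e \o shift x = cst (e x) + (\0 : {linear V -> W}) +o_ 0 id.
  apply/eqaddoP => _/posnumP[d]; rewrite ex.
  have : \forall h \near (0 : V), e (h + x) = 0.
    by move: e0; rewrite (near_shift 0) subr0; apply.
  apply: filterS => h /= eh.
  have -> : (e \o shift x - (cst 0 + (\0 : {linear V -> W}))) h = 0.
    by rewrite !fctE /= eh addr0 subrr.
  by rewrite normr0 mulr_ge0.
have dE : 'd e x = (\0 : {linear V -> W}) :> (V -> W).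
  by apply: diff_unique eo; exact: cst_continuous.
by apply/diff_locallyP; rewrite dE; split => //; exact: cst_continuous.
Qed.

Lemma near_differentiable (f g : V -> W) x :
  (\forall y \near x, f y = g y) -> differentiable f x -> differentiable g x.
Proof.
move=> fg df; have -> : g = f + (g - f).
  by apply/funext => y; rewrite !fctE addrC subrK.
apply: differentiableD; first exact: df.
apply: near0_differentiable.
by apply: filterS fg => y fy; rewrite !fctE fy subrr.
Qed.

End NearDifferentiable.

Section CkClosure.
Variables (R : realType) (V : normedModType R) (O : set V).
Hypothesis O_open : open O.

Let O_nbhs x : O x -> nbhs x O.
Proof. by move=> Ox; exact: open_nbhs_nbhs. Qed.

Lemma Ck_on_ext (W : normedModType R) k (f g : V -> W) :
  (forall x, O x -> f x = g x) -> Ck_on k O f -> Ck_on k O g.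
Proof.
elim: k f g => [|k IH] f g fg /=.
  move=> fc x Ox; have nfg : \forall y \near x, f y = g y.
    by apply: filterS (O_nbhs Ox) => y /fg.
  rewrite /prop_for /continuous_at -(fg x Ox).
  apply: cvg_trans (fc x Ox); apply: near_eq_cvg.
  by apply: filterS nfg => y ->.
have nfg x : O x -> \forall y \near x, f y = g y.
  by move=> Ox; apply: filterS (O_nbhs Ox) => y /fg.
move=> [fd fD]; split=> [x Ox|v].
  exact: near_differentiable (nfg x Ox) (fd x Ox).
apply: IH (fD v) => x Ox; exact: near_eq_derive (nfg x Ox).
Qed.

Lemma Ck_onS (W : normedModType R) k (f : V -> W) : Ck_on k.+1 O f -> Ck_on k O f.
Proof.
elim: k f => [|k IH] f [fd fD].
  by move=> x Ox; apply: differentiable_continuous; exact: fd.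
by split=> // v; apply: IH; exact: fD.
Qed.

(** The derivatives may be computed by any formula valid on O only. *)
Lemma Ck_on_step (W : normedModType R) k (f : V -> W) (D : V -> V -> W) :
  (forall x, O x -> differentiable f x) ->
  (forall v x, O x -> 'D_v f x = D v x) ->
  (forall v, Ck_on k O (D v)) -> Ck_on k.+1 O f.
Proof.
by move=> fd fD DC; split=> // v; apply: Ck_on_ext (DC v) => x Ox; rewrite fD.
Qed.

Lemma Ck_on_cst (W : normedModType R) k (a : W) : Ck_on k O (cst a).
Proof.
elim: k a => [|k IH] a; first by move=> x _; exact: cst_continuous.
apply: (@Ck_on_step _ _ _ (fun _ => cst 0)) => [x _|v x _|v].
- exact: differentiable_cst.
- exact: derive_cst.
- exact: IH.
Qed.

Lemma Ck_onD (W : normedModType R) k (f g : V -> W) :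
  Ck_on k O f -> Ck_on k O g -> Ck_on k O (f + g).
Proof.
elim: k f g => [|k IH] f g.
  by move=> fc gc x Ox; apply: continuousD; [exact: fc|exact: gc].
move=> [fd fD] [gd gD].
apply: (@Ck_on_step _ _ _ (fun v => ('D_v f) + ('D_v g))) => [x Ox|v x Ox|v].
- by apply: differentiableD; [exact: fd|exact: gd].
- by rewrite deriveD//; apply: diff_derivable; [exact: fd|exact: gd].
- by apply: IH; [exact: fD|exact: gD].
Qed.

Lemma Ck_on_sum (W : normedModType R) k (I : Type) (s : seq I) (f : I -> V -> W) :
  (forall i, Ck_on k O (f i)) -> Ck_on k O (fun x => \sum_(i <- s) f i x).
Proof.
move=> fC; elim: s => [|i s IH].
  by apply: Ck_on_ext (Ck_on_cst k 0) => x _; rewrite big_nil.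
by apply: Ck_on_ext (Ck_onD (fC i) IH) => x _; rewrite big_cons.
Qed.

Lemma Ck_onM k (f g : V -> R) :
  Ck_on k O f -> Ck_on k O g -> Ck_on k O (fun x => f x * g x).
Proof.
elim: k f g => [|k IH] f g.
  by move=> fc gc x Ox; apply: continuousM; [exact: fc|exact: gc].
move=> fC gC; have [fd fD] := fC; have [gd gD] := gC.
apply: (@Ck_on_step _ _ _ (fun v => (fun x => f x * 'D_v g x) + (fun x => g x * 'D_v f x))) => [x Ox|v x Ox|v].
- by apply: (@differentiableM _ _ f g); [exact: fd|exact: gd].
- by apply: (@deriveM R V f g x v); apply: diff_derivable; auto.
- have fS := Ck_onS fC; have gS := Ck_onS gC.
  by apply: Ck_onD; apply: IH => //; [exact: gD|exact: fD].
Qed.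

Lemma Ck_onZl (W : normedModType R) k (f : V -> R) (w : W) :
  Ck_on k O f -> Ck_on k O (fun x => f x *: w).
Proof.
elim: k f => [|k IH] f.
  move=> fc x Ox; apply: (@continuous_comp _ _ _ f (fun r => r *: w)); first exact: fc.
  exact: scalel_continuous.
move=> [fd fD]; apply: (@Ck_on_step _ _ _ (fun v x => 'D_v f x *: w)) => [x Ox|v x Ox|v].
- by apply: differentiableZl; exact: fd.
- rewrite deriveE; last by apply: differentiableZl; exact: fd.
  by rewrite diffZl ?deriveE//; exact: fd.
- by apply: IH; exact: fD.
Qed.

Lemma Ck_onV k (f : V -> R) : (forall x, O x -> f x != 0) ->
  Ck_on k O f -> Ck_on k O (fun x => (f x)^-1).
Proof.
move=> f0; elim: k => [|k IH].
  by move=> fc x Ox; apply: continuousV; [exact: f0|exact: fc].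
move=> fC; have [fd fD] := fC; have iC := IH (Ck_onS fC).
apply: (@Ck_on_step _ _ _ (fun v x => (-1 * ((f x)^-1 * (f x)^-1)) * 'D_v f x)) => [x Ox|v x Ox|v].
- by apply: (@differentiableV _ _ f); [exact: fd|exact: f0].
- rewrite (@deriveV _ _ f)//; [|exact: f0|by apply: diff_derivable; exact: fd].
  by rewrite /GRing.scale/= -exprVn expr2; ring.
- apply: Ck_onM; last exact: fD.
  by apply: Ck_onM; [exact: (Ck_on_cst k (-1 : R))|exact: Ck_onM].
Qed.

End CkClosure.

Section CkComposition.
Variable R : realType.

Lemma Ck_on_linear (V W : normedModType R) k (f : {linear V -> W}) :
  continuous f -> Ck_on k setT f.
Proof.
move=> fc; case: k => [|k]; first by move=> x _; exact: fc.
apply: (@Ck_on_step _ _ _ openT _ _ _ (fun v => cst (f v))) => [x _|v x _|v].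
- exact: linear_differentiable.
- by rewrite deriveE ?diff_lin//; exact: linear_differentiable.
- by apply: Ck_on_cst; exact: openT.
Qed.

Lemma Ck_on_comp_linear (U V W : normedModType R) k (L : {linear U -> V}) (f : V -> W) :
  continuous L -> Ck_on k setT f -> Ck_on k setT (f \o L).
Proof.
move=> Lc; elim: k f => [|k IH] f /=.
  by move=> fc x _; apply: continuous_comp; [exact: Lc|exact: fc].
move=> [fd fD].
apply: (@Ck_on_step _ _ _ openT _ _ _ (fun v x => 'D_(L v) f (L x))) => [x _|v x _|v].
- by apply: differentiable_comp; [exact: linear_differentiable|exact: fd].
- rewrite deriveE; last first.
    by apply: differentiable_comp; [exact: linear_differentiable|exact: fd].
  rewrite diff_comp; [|exact: linear_differentiable|exact: fd].
  by rewrite /= diff_lin// deriveE//; exact: fd.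
- exact: (IH (fun y => 'D_(L v) f y) (fD _)).
Qed.

Lemma derive_comp1 (V : normedModType R) (g : R -> R) (f : V -> R) x v :
  differentiable f x -> differentiable g (f x) ->
  'D_v (g \o f) x = 'D_1 g (f x) * 'D_v f x.
Proof.
move=> fd gd; rewrite deriveE; last exact: differentiable_comp.
rewrite diff_comp// /= deriveE// deriveE//.
by rewrite -[X in 'd g _ X]mulr1 [LHS]linearZ/= mulrC.
Qed.

End CkComposition.

Section SmoothMaps.
Variable R : realType.

Lemma smooth_differentiable (V W : normedModType R) (f : V -> W) x :
  smooth f -> differentiable f x.
Proof. by move=> fs; have [fd _] := fs 1%N; exact: fd. Qed.

Lemma smooth_derive (V W : normedModType R) (f : V -> W) v : smooth f -> smooth (fun x => 'D_v f x).
Proof. by move=> fs k; have [_ fD] := fs k.+1; exact: fD. Qed.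

Lemma smooth_continuous (V W : normedModType R) (f : V -> W) : smooth f -> continuous f.
Proof. by move=> fs x; apply: differentiable_continuous; exact: smooth_differentiable. Qed.

Lemma smooth_id (V : normedModType R) : smooth (fun x : V => x).
Proof.
by move=> k; apply: (@Ck_on_linear _ _ _ _ (idfun : {linear V -> V})) => x; exact: cvg_id.
Qed.

Lemma smooth_comp_linear (V W X : normedModType R) (L : V -> W) (f : W -> X) :
  linear L -> continuous L -> smooth f -> smooth (f \o L).
Proof.
move=> lin Lc fs k.
pose lM := GRing.isLinear.Build _ _ _ _ _ lin.
pose L' : {linear V -> W} := HB.pack L lM.
exact: (@Ck_on_comp_linear _ _ _ _ _ L').
Qed.

End SmoothMaps.

(** * Bootstrapping along curves and through inverse functions *)

Section CurveBootstrap.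
Variables (R : realType) (n : nat).
Implicit Types (f h : 'rV[R]_n -> R) (gam : R -> 'rV[R]_n).

(** The chain rule, with the differential of h expanded on the canonical basis. *)
Lemma derive_along_curve h gam (t : R) (w : 'rV[R]_n) :
  differentiable h (gam t) -> is_derive t 1 gam w ->
  is_derive t 1 (h \o gam) (\sum_i w 0 i * 'D_(delta_mx 0 i) h (gam t)).
Proof.
move=> hd [gd gE]; have gdiff : differentiable gam t by apply/derivable1_diffP.
split; first by apply/derivable1_diffP; exact: differentiable_comp.
rewrite deriveE; last exact: differentiable_comp.
have dE : 'd gam t 1 = w by rewrite -deriveE.
rewrite diff_comp// [LHS]/= dE [in LHS](row_sum_delta w) linear_sum/=.
by apply: eq_bigr => i _; rewrite linearZ/= deriveE.
Qed.

Lemma grad_entry f x i : grad f x 0 i = 'D_(delta_mx 0 i) f x.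
Proof. by rewrite mxE. Qed.

(** The derivative of h o gamma is q o gamma with q = <grad f, grad h> again
    smooth; quantifying over all smooth h makes the induction on k go through. *)
Lemma smooth_along_ascent f gam : smooth f ->
  (forall t : R, is_derive t 1 gam (grad f (gam t))) ->
  forall h, smooth h -> smooth (h \o gam).
Proof.
move=> fs gf h hs k; elim: k h hs => [|k IH] h hs.
  move=> t _; apply: (@continuous_comp _ _ _ gam h).
    by apply/differentiable_continuous/derivable1_diffP; case: (gf t).
  by apply: differentiable_continuous; exact: smooth_differentiable.
pose q : 'rV[R]_n -> R := fun x => \sum_i 'D_(delta_mx 0 i) f x * 'D_(delta_mx 0 i) h x.
have hd (t : R) : is_derive t 1 (h \o gam) (q (gam t)).
  have := derive_along_curve (smooth_differentiable (gam t) hs) (gf t).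
  by under eq_bigr do rewrite grad_entry.
have hdiff (t : R) : differentiable (h \o gam) t.
  by apply/derivable1_diffP; case: (hd t).
apply: (@Ck_on_step R R setT openT R k (h \o gam) (fun v t : R => v * (q \o gam) t)) => [t _|v t _|v].
- exact: hdiff.
- rewrite deriveE// -[v in 'd _ _ v]mulr1 [LHS]linearZ/= -deriveE//.
  by case: (hd t) => _ ->.
- apply: (@Ck_onM _ _ _ openT); first exact: (Ck_on_cst openT).
  apply: IH => k'; apply: (Ck_on_sum openT) => i.
  by apply: (Ck_onM openT); apply: smooth_derive.
Qed.

Lemma smooth_comp_coord (h : R -> R) i : smooth h ->
  smooth (fun x : 'rV[R]_n => h (x 0 i)).
Proof.
apply: (@smooth_comp_linear R 'rV[R]_n R R (fun x : 'rV[R]_n => x 0 i)).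
  by move=> a x y; rewrite !mxE.
exact: coord_continuous.
Qed.

Lemma smooth_coord i : smooth (fun x : 'rV[R]_n => x 0 i : R).
Proof.
exact: (@smooth_comp_coord (fun t => t) i (@smooth_id R R)).
Qed.

End CurveBootstrap.

Section InverseBootstrap.
Variables (R : realType) (V : normedModType R).

(** Same bootstrap for a function h of several variables: D_v (u o h) is D_v f
    times (u' w) o h, and u' w is smooth. *)
Lemma Ck_on_implicit (O : set V) (f h : V -> R) (w : R -> R) : open O ->
  (forall k, Ck_on k O f) -> smooth w ->
  (forall x, O x -> differentiable h x) ->
  (forall v x, O x -> 'D_v h x = 'D_v f x * w (h x)) ->
  forall u : R -> R, smooth u -> forall k, Ck_on k O (u \o h).
Proof.
move=> Oo fC ws hd hD u us k; elim: k u us => [|k IH] u us.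
  move=> x Ox; apply: (@continuous_comp _ _ _ h u).
    by apply: differentiable_continuous; exact: hd.
  by apply: differentiable_continuous; exact: smooth_differentiable.
apply: (@Ck_on_step _ _ _ Oo _ _ _
   (fun v x => 'D_v f x * ((fun y => 'D_1 u y * w y) \o h) x)) => [x Ox|v x Ox|v].
- by apply: differentiable_comp; [exact: hd|exact: smooth_differentiable].
- rewrite derive_comp1; [|exact: hd|exact: smooth_differentiable].
  by rewrite hD// mulrCA.
- apply: (Ck_onM Oo); first by have [_ fD] := fC k.+1; exact: fD.
  by apply: IH => k'; apply: (Ck_onM openT) => //; exact: smooth_derive.
Qed.

End InverseBootstrap.

Lemma Ck_on_subset (R : realType) (V W : normedModType R) k (O O' : set V) (f : V -> W) :
  O' `<=` O -> Ck_on k O f -> Ck_on k O' f.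
Proof.
move=> sub; elim: k f => [|k IH] f /=; first by move=> fc x /sub; exact: fc.
by move=> [fd fD]; split=> [x /sub /fd //|v]; apply: IH.
Qed.

Section SmoothReal.
Variable R : realType.
Implicit Types F : R -> R.

Lemma smooth_is_derive F (t : R) : smooth F -> is_derive t 1 F ('D_1 F t).
Proof.
by move=> Fs; apply: derivableP; apply/derivable1_diffP; exact: smooth_differentiable.
Qed.

Lemma segment_bounded (f : R -> R) (a b : R) : continuous f ->
  exists2 K, 0 <= K & forall t, a <= t <= b -> `|f t| <= K.
Proof.
move=> fc; have [ab|ba] := leP a b; last first.
  by exists 0 => // t; lra.
have nc : {within `[a, b], continuous (fun t => `|f t|)}.
  apply: continuous_subspaceT => x.
  by apply: (@continuous_comp _ _ _ f Num.norm); [exact: fc|exact: norm_continuous].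
have [m mab mmax] := EVT_max ab nc.
by exists `|f m| => // t tab; apply: mmax; rewrite in_itv.
Qed.

Lemma smooth_lipschitz_segment F (r : R) : smooth F -> exists2 K, 0 <= K &
  forall x y, `|x| <= r -> `|y| <= r -> `|F x - F y| <= K * `|x - y|.
Proof.
move=> Fs; have [K K0 HK] := segment_bounded (- r) r (smooth_continuous (smooth_derive (1 : R) Fs)).
exists K => // x y; wlog xy : x y / x <= y.
  by move=> W xr yr; case: (leP x y) => [/W|/ltW/W]; [|rewrite distrC (distrC x)]; apply.
move=> /ler_normlP[xr1 xr2] /ler_normlP[yr1 yr2].
rewrite distrC [X in K * X]distrC (ger0_norm (_ : 0 <= y - x)) ?subr_ge0//.
rewrite mulrBr; apply: (@deriv_norm_le R F ( *%R K) (fun t => 'D_1 F t) (fun=> K)) => // t.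
- by move=> _; exact: smooth_is_derive.
- by move=> _; exact: is_derive_mull.
- by move=> xty; apply: HK; lra.
Qed.

Variable F : R -> R.
Hypothesis F_smooth : smooth F.
Hypothesis F_pos : forall t : R, 0 < 'D_1 F t.

Lemma increasing_of_deriv : {homo F : x y / x < y}.
Proof.
move=> x y xy.
have [||c cxy E] := @MVT R F (fun t => 'D_1 F t) x y xy.
- by move=> t _; exact: smooth_is_derive.
- by apply: continuous_subspaceT; exact: smooth_continuous.
by rewrite -subr_gt0 E mulr_gt0// subr_gt0.
Qed.

Lemma increasing_inj : injective F.
Proof.
move=> x y E; apply/eqP; rewrite eq_le !leNgt.
by apply/andP; split; apply/negP => /increasing_of_deriv; rewrite E ltxx.
Qed.

(** Meaningful on the range of F, which need not be the whole line. *)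
Definition inverse (y : R) : R := xget 0 [set t | F t = y].

Lemma inverseK : cancel F inverse.
Proof.
move=> t; apply: increasing_inj.
exact: (@xgetPex _ 0 [set s | F s = F t] (ex_intro _ t erefl)).
Qed.

Lemma range_increasing_open : open (range F).
Proof.
rewrite openE => _ [t _ <-].
have h1 : F (t - 1) < F t by apply: increasing_of_deriv; lra.
have h2 : F t < F (t + 1) by apply: increasing_of_deriv; lra.
have n1 : \forall y \near F t, F (t - 1) < y := lt_nbhsr h1.
have n2 : \forall y \near F t, y < F (t + 1) := lt_nbhsl h2.
suff : \forall y \near F t, range F y by [].
near=> y.
have y1 : F (t - 1) < y by near: y.
have y2 : y < F (t + 1) by near: y.
have [|||s _ sy] := @IVT R F (t - 1) (t + 1) y.
- lra.
- by apply: continuous_subspaceT; exact: smooth_continuous.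
- rewrite ge_min le_max; apply/andP; split; apply/orP; [left|right]; exact: ltW.
by exists s.
Unshelve. all: by end_near. Qed.

Lemma inverse_derive (t : R) : is_derive (F t) 1 inverse ('D_1 F t)^-1.
Proof.
apply: is_derive_inverse; last by rewrite gt_eqF.
- by near=> s; exact: inverseK.
- by near=> s; exact: smooth_continuous.
- exact: smooth_is_derive.
Unshelve. all: by end_near. Qed.

(** h = F^-1 o f satisfies D_v h = D_v f / F'(h), whence [Ck_on_implicit] with
    w = 1/F'. *)
Lemma inverse_comp_Ck (V : normedModType R) (f : V -> R) k : smooth f ->
  Ck_on k (f @^-1` (range F)) (inverse \o f).
Proof.
move=> fs.
have Oo : open (f @^-1` (range F)).
  by apply: open_comp; [move=> x _; exact: smooth_continuous|exact: range_increasing_open].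
have fC k' : Ck_on k' (f @^-1` (range F)) f.
  exact: Ck_on_subset (fs k').
pose w (t : R) := ('D_1 F t)^-1.
have ws : smooth w.
  move=> k'; apply: (Ck_onV openT); first by move=> t _; rewrite gt_eqF.
  exact: smooth_derive.
have idE : inverse \o f = id \o (inverse \o f) by [].
rewrite idE; apply: (Ck_on_implicit (f := f) (w := w)) => //.
- move=> x [t _ tx] /=; apply: differentiable_comp; first exact: smooth_differentiable.
  by rewrite -tx; apply/derivable1_diffP; case: (inverse_derive t).
- move=> v x [t _ tx].
  have dt := inverse_derive t.
  rewrite derive_comp1; [|exact: smooth_differentiable|]; last first.
    by rewrite -tx; apply/derivable1_diffP; case: dt.
  rewrite mulrC /w /= -tx inverseK; congr (_ * _).
  by case: dt => _ ->.
exact: smooth_id.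
Qed.

End SmoothReal.

(** * Gradient ascent curves *)

Lemma mul_le_of_sqr (R : realType) (x y S : R) : x ^+ 2 <= S -> y ^+ 2 <= S -> x * y <= S.
Proof.
have := sqr_ge0 (x - y).
have -> : (x - y) ^+ 2 = x ^+ 2 + y ^+ 2 - 2 * (x * y) by ring.
move: (x ^+ 2) (y ^+ 2) (x * y) => p q r; lra.
Qed.

Section Ascent.
Variables (R : realType) (n : nat) (f : 'rV[R]_n -> R) (x0 : 'rV[R]_n) (gam : R -> 'rV[R]_n).
Hypothesis f_smooth : smooth f.
Hypothesis x0_regular : grad f x0 != 0.
Hypothesis gam_curve : integral_curve (grad f) x0 gam.

Let a i (t : R) := 'D_(delta_mx 0 i) f (gam t).
Let H i j (t : R) := 'D_(delta_mx 0 j) (fun x => 'D_(delta_mx 0 i) f x) (gam t).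

Let gam_derive (t : R) : is_derive t 1 gam (grad f (gam t)).
Proof. by case: gam_curve. Qed.

Let a_derive i (t : R) : is_derive t 1 (a i) (\sum_j a j t * H i j t).
Proof.
have hd : differentiable (fun x => 'D_(delta_mx 0 i) f x) (gam t).
  by apply: smooth_differentiable; exact: smooth_derive.
have := derive_along_curve hd (gam_derive t).
by under eq_bigr do rewrite grad_entry.
Qed.

Lemma ascent_derive (t : R) : 'D_1 (f \o gam) t = \sum_i a i t ^+ 2.
Proof.
have [_ ->] := derive_along_curve (smooth_differentiable (gam t) f_smooth) (gam_derive t).
by apply: eq_bigr => i _; rewrite grad_entry expr2.
Qed.

(** The squared speed s = |grad f|^2 along the curve satisfies |s'| <= 2 C s, with C
    the sum of the absolute values of the entries of the Hessian along the curve,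
    which is bounded on compact time intervals. By Gronwall, s cannot vanish at
    some time without vanishing at time 0. *)
Lemma ascent_speed_pos (t : R) : 0 < 'D_1 (f \o gam) t.
Proof.
pose s t := \sum_i a i t ^+ 2.
pose ds t := \sum_i 2 * a i t * (\sum_j a j t * H i j t).
have s_derive (u : R) : is_derive u 1 s (ds u).
  rewrite /s /ds -fct_sumE; apply: is_derive_sum => i.
  have := @is_deriveX R R (a i) 2 u 1 _ (a_derive i u).
  rewrite /GRing.scale/= expr1 => E.
  by rewrite (_ : (fun x => _) = (a i) ^+ 2)//.
have s0 u : 0 <= s u by rewrite sumr_ge0// => i _; rewrite sqr_ge0.
pose C u := \sum_i \sum_j `|H i j u|.
have C_cont : continuous C.
  have Hs i j : continuous (H i j).
    apply: smooth_continuous; apply: (smooth_along_ascent f_smooth gam_derive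
      (h := fun x => 'D_(delta_mx 0 j) (fun x => 'D_(delta_mx 0 i) f x) x)).
    by do 2 apply: smooth_derive.
  suff : Ck_on 0 setT C by move=> Cc u; exact: Cc.
  apply: (Ck_on_sum openT) => i; apply: (Ck_on_sum openT) => j u _.
  by apply: (@continuous_comp _ _ _ (H i j) Num.norm); [exact: Hs|exact: norm_continuous].
have ds_le u : `|ds u| <= 2 * C u * s u.
  have as_ i : `|a i u| ^+ 2 <= s u.
    by rewrite real_normK ?num_real// /s (bigD1 i)//= lerDl sumr_ge0// => j _; rewrite sqr_ge0.
  have aa i j : `|a i u| * `|a j u| <= s u.
    exact: mul_le_of_sqr (as_ i) (as_ j).
  have [S SE] : exists S, S = s u by exists (s u).
  rewrite -SE in aa *.
  rewrite /C mulr_sumr mulr_suml; apply: le_trans (ler_norm_sum _ _ _) _.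
  apply: ler_sum => i _; rewrite mulr_sumr; apply: le_trans (ler_norm_sum _ _ _) _.
  rewrite mulr_sumr mulr_suml; apply: ler_sum => j _; rewrite !normrM normr_nat.
  have -> : 2 * `|a i u| * (`|a j u| * `|H i j u|) =
     2 * `|H i j u| * (`|a i u| * `|a j u|) by ring.
  by apply: ler_wpM2l => //; exact: mulr_ge0.
have spos0 : 0 < s 0.
  rewrite lt_neqAle s0 andbT eq_sym; apply: contraNneq x0_regular => /eqP.
  rewrite psumr_eq0 => [/allP all0|i _]; last exact: sqr_ge0.
  apply/eqP/rowP => i; have := all0 i (mem_index_enum i).
  by rewrite sqrf_eq0 /a => /eqP; rewrite mxE; case: gam_curve => ->; rewrite mxE.
rewrite ascent_derive -/(s t).
have [K K0 HK] := segment_bounded (- `|t|) `|t| C_cont.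
have dK u : - `|t| <= u <= `|t| -> `|ds u| <= 2 * K * s u.
  move=> ut; apply: le_trans (ds_le u) _; rewrite ler_wpM2r// ler_wpM2l//.
  by apply: le_trans (ler_norm _) (HK u ut).
rewrite ltNge; apply/negP => st.
have [t0|t0] := leP 0 t.
  have := @gronwall_back R s ds (2 * K) 0 t t0 (fun u _ => s_derive u).
  move=> h; have {h} : s 0 <= s t * expR (2 * K * (t - 0)).
    apply: h => u ut; have := dK u; rewrite (ger0_norm t0) => /(_ _)/ler_normlP[].
      lra.
    by rewrite mulNr; lra.
  have := expR_gt0 (2 * K * (t - 0)); move: (expR _) => e e0 h.
  have : s t * e <= 0 by rewrite mulr_le0_ge0// ltW.
  lra.
have := @gronwall R s ds (2 * K) t 0 (ltW t0) (fun u _ => s_derive u).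
move=> h; have {h} : s 0 <= s t * expR (2 * K * (0 - t)).
  apply: h => u ut; have := dK u; rewrite (ltr0_norm t0) => /(_ _)/ler_normlP[] //.
  lra.
have := expR_gt0 (2 * K * (0 - t)); move: (expR _) => e e0 h.
have : s t * e <= 0 by rewrite mulr_le0_ge0// ltW.
lra.
Qed.

Lemma ascent_value_smooth : smooth (f \o gam).
Proof. exact: smooth_along_ascent f_smooth gam_derive _ f_smooth. Qed.

Lemma ascent_coord_smooth i : smooth (fun t => gam t 0 i).
Proof.
exact: (smooth_along_ascent f_smooth gam_derive (@smooth_coord R n i)).
Qed.

End Ascent.

(** * Fully mixed equilibria *)

Section FullyMixed.
Variables (R : realType) (N M : nat) (U : 'M[R]_(N, M)).

Lemma payoff_rowE x y : payoff U x y = \sum_i x i 0 * (\sum_j U i j * y j 0).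
Proof.
rewrite /payoff -mulmxA mxE; apply: eq_bigr => i _; rewrite !mxE.
by congr (_ * _); apply: eq_bigr => j _.
Qed.

Lemma payoff_colE x y : payoff U x y = \sum_j y j 0 * (\sum_i U i j * x i 0).
Proof.
rewrite payoff_rowE; under eq_bigr do rewrite mulr_sumr.
rewrite exchange_big; apply: eq_bigr => j _; rewrite mulr_sumr.
by apply: eq_bigr => i _; ring.
Qed.

Lemma prob_vec_delta n (i : 'I_n) : prob_vec (delta_mx i 0 : 'cV[R]_n).
Proof.
split=> [j|]; first by rewrite mxE ler0n.
rewrite (bigD1 i)//= !mxE !eqxx big1 ?addr0// => j ji.
by rewrite mxE (negbTE ji).
Qed.

Lemma sum_delta n (i : 'I_n) (h : 'I_n -> R) :
  \sum_j (delta_mx i 0 : 'cV[R]_n) j 0 * h j = h i.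
Proof.
rewrite (bigD1 i)//= !mxE !eqxx mul1r big1 ?addr0// => j ji.
by rewrite mxE (negbTE ji) mul0r.
Qed.

Lemma average_attained n (w h : 'I_n -> R) (c : R) :
  (forall i, 0 < w i) -> (forall i, 0 <= h i - c) ->
  \sum_i w i = 1 -> \sum_i w i * h i = c -> forall i, h i = c.
Proof.
move=> w0 hc w1 wh i.
have : \sum_i w i * (h i - c) = 0.
  under eq_bigr do rewrite mulrBr.
  by rewrite sumrB wh -mulr_suml w1 mul1r subrr.
move/eqP; rewrite psumr_eq0 => [/allP /(_ i (mem_index_enum i))|j _]; last first.
  by rewrite mulr_ge0// ltW.
by rewrite mulf_eq0 gt_eqF//= subr_eq0 => /eqP.
Qed.

(** Against q, no pure strategy of the row player pays less than v = p^T U q, and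
    their average with the positive weights p is v; hence each of them pays exactly
    v. Likewise for the column player. *)
Lemma fully_mixed_nash_indifferent p q : fully_mixed_nash U p q ->
  exists v, (forall i, \sum_j U i j * q j 0 = v) /\
            (forall j, \sum_i U i j * p i 0 = v).
Proof.
move=> [[[_ p1] p0] [[_ q1] q0] pmin qmax]; exists (payoff U p q); split.
  apply: (average_attained p0); rewrite -?payoff_rowE// => i.
  by rewrite subr_ge0; have := pmin _ (prob_vec_delta i); rewrite [leRHS]payoff_rowE sum_delta.
move=> j; apply: oppr_inj; move: j.
apply: (average_attained q0) => //.
  move=> j; rewrite opprK addrC subr_ge0.
  by have := qmax _ (prob_vec_delta j); rewrite [leLHS]payoff_colE sum_delta.
by under eq_bigr do rewrite mulrN; rewrite sumrN -payoff_colE.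
Qed.

End FullyMixed.

(** * Coordinates on the state space *)

Section StateCoordinates.
Variables (R : realType) (N M : nat) (n : 'I_N -> nat) (m : 'I_M -> nat).

Definition theta_basis l : state R n m := (delta_mx 0 l, 0, 0, 0).
Definition phi_basis l : state R n m := (0, delta_mx 0 l, 0, 0).
Definition lambda_basis : state R n m := (0, 0, 1, 0).
Definition mu_basis : state R n m := (0, 0, 0, 1).

Lemma fst_sum (A B : zmodType) (I : Type) (s : seq I) (h : I -> (A * B)%type) :
  (\sum_(i <- s) h i).1 = \sum_(i <- s) (h i).1.
Proof. exact: (big_morph (fun z : (A * B)%type => z.1)). Qed.

Lemma snd_sum (A B : zmodType) (I : Type) (s : seq I) (h : I -> (A * B)%type) :
  (\sum_(i <- s) h i).2 = \sum_(i <- s) (h i).2.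
Proof. exact: (big_morph (fun z : (A * B)%type => z.2)). Qed.

Lemma fstD (A B : zmodType) (x y : (A * B)%type) : (x + y).1 = x.1 + y.1.
Proof. by []. Qed.

Lemma sndD (A B : zmodType) (x y : (A * B)%type) : (x + y).2 = x.2 + y.2.
Proof. by []. Qed.

Lemma state_ext (z z' : state R n m) : z.1.1.1 = z'.1.1.1 ->
  z.1.1.2 = z'.1.1.2 -> z.1.2 = z'.1.2 -> z.2 = z'.2 -> z = z'.
Proof. by case: z z' => [[[? ?] ?] ?] [[[? ?] ?] ?] /= -> -> -> ->. Qed.

(** Writing a state as a sum of scalars times fixed vectors reduces smoothness and
    differentiation of state-valued maps to the scalar case. *)
Lemma mkstate_sum (theta : forall i, 'rV[R]_(n i)) (phi : forall j, 'rV[R]_(m j)) (lam mu : R) :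
  mkstate theta phi lam mu =
  \sum_l theta (tagnat.sig1 l) 0 (tagnat.sig2 l) *: theta_basis l +
  \sum_l phi (tagnat.sig1 l) 0 (tagnat.sig2 l) *: phi_basis l +
  lam *: lambda_basis + mu *: mu_basis.
Proof.
apply: state_ext.
- rewrite !(fstD, fst_sum)/= !scaler0 [X in _ + X + _ + _]big1 ?addr0 => [|l _]; last exact: scaler0.
  by rewrite [LHS]row_sum_delta; apply: eq_bigr => l _; rewrite mxE.
- rewrite !(fstD, sndD, fst_sum, snd_sum)/= !scaler0 [X in X + _ + _ + _]big1 ?addr0 ?add0r => [|l _]; last exact: scaler0.
  by rewrite [LHS]row_sum_delta; apply: eq_bigr => l _; rewrite mxE.
- rewrite !(fstD, sndD, fst_sum, snd_sum)/= !big1 => [|l _|l _]; try exact: scaler0.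
  by rewrite /GRing.scale/= mulr1 mulr0 addr0 !add0r.
- rewrite !(sndD, snd_sum)/= !big1 => [|l _|l _]; try exact: scaler0.
  by rewrite /GRing.scale/= mulr1 mulr0 !add0r.
Qed.

End StateCoordinates.

Section SumRules.
Variable R : realType.

Lemma Ck_on_add (V W : normedModType R) (O : set V) k (f g : V -> W) : open O ->
  Ck_on k O f -> Ck_on k O g -> Ck_on k O (fun x => f x + g x).
Proof. by move=> Oo fC gC; exact: (Ck_onD Oo fC gC). Qed.

Lemma is_derive_add (V W : normedModType R) (f g : V -> W) x v df dg :
  is_derive x v f df -> is_derive x v g dg ->
  is_derive x v (fun y => f y + g y) (df + dg).
Proof. by move=> fd gd; exact: is_deriveD. Qed.

Lemma is_derive_bigsum (V W : normedModType R) (l : nat) (h : 'I_l -> V -> W) x v dh :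
  (forall i, is_derive x v (h i) (dh i)) ->
  is_derive x v (fun y => \sum_i h i y) (\sum_i dh i).
Proof.
move=> hd; rewrite (_ : (fun y => _) = \sum_i h i); last by rewrite fct_sumE.
exact: is_derive_sum.
Qed.

Lemma is_derive_scalel (W : normedModType R) (h : R -> R) (w : W) (t d : R) :
  is_derive t 1 h d -> is_derive t 1 (fun s => h s *: w) (d *: w).
Proof.
move=> [hd hE]; have hdiff : differentiable h t by apply/derivable1_diffP.
split; first by apply/derivable1_diffP; exact: differentiableZl.
rewrite deriveE; last exact: differentiableZl.
by rewrite diffZl// -deriveE// hE.
Qed.

Lemma is_derive_entry l (c : R -> 'rV[R]_l) (t : R) w i :
  is_derive t 1 c w -> is_derive t 1 (fun s => c s 0 i) (w 0 i).
Proof.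
move=> [cd cE]; split; first by have /derivable_mxP := cd.
by have := derive_mx cd; rewrite cE => ->; rewrite mxE.
Qed.

End SumRules.

Section StateBlocks.
Variables (R : realType) (N M : nat) (n : 'I_N -> nat) (m : 'I_M -> nat).

Lemma submxrow_continuous (l : nat) (d : 'I_l -> nat) i :
  continuous (fun x : 'rV[R]_(\sum_i d i) => submxrow x i).
Proof.
apply: (@lipschitz_continuous _ _ _ _ 1) => x y; rewrite mul1r.
by apply: norm_rowB_le => // j; rewrite !mxE; exact: norm_coordB_le.
Qed.

Let fst1_continuous (A B C : topologicalType) :
  continuous (fun z : A * B * C => z.1.1).
Proof.
by move=> z; apply: (@continuous_comp _ _ _ fst fst); exact: cvg_fst.
Qed.

Let linear_fst (A B C D W : lmodType R) (L : A -> W) :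
  linear L -> linear (fun z : A * B * C * D => L z.1.1.1).
Proof. by move=> lin a x y; exact: lin. Qed.

Let linear_snd (A B C D W : lmodType R) (L : B -> W) :
  linear L -> linear (fun z : A * B * C * D => L z.1.1.2).
Proof. by move=> lin a x y; exact: lin. Qed.

Lemma theta_block_linear i : linear (fun z : state R n m => submxrow z.1.1.1 i).
Proof. by apply: linear_fst; exact: linearP. Qed.

Lemma phi_block_linear j : linear (fun z : state R n m => submxrow z.1.1.2 j).
Proof. by apply: linear_snd; exact: linearP. Qed.

Lemma theta_block_continuous i : continuous (fun z : state R n m => submxrow z.1.1.1 i).
Proof.
move=> z; apply: (@continuous_comp _ _ _ (fun z : state R n m => z.1.1.1)
   (fun x => submxrow x i)); last exact: submxrow_continuous.
apply: (@continuous_comp _ _ _ (fun z : state R n m => z.1.1) fst); last exact: cvg_fst.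
exact: fst1_continuous.
Qed.

Lemma phi_block_continuous j : continuous (fun z : state R n m => submxrow z.1.1.2 j).
Proof.
move=> z; apply: (@continuous_comp _ _ _ (fun z : state R n m => z.1.1.2)
   (fun x => submxrow x j)); last exact: submxrow_continuous.
apply: (@continuous_comp _ _ _ (fun z : state R n m => z.1.1) snd); last exact: cvg_snd.
exact: fst1_continuous.
Qed.

Lemma smooth_theta_block i (h : 'rV[R]_(n i) -> R) : smooth h ->
  smooth (fun z : state R n m => h (submxrow z.1.1.1 i)).
Proof.
move=> hs; exact: (@smooth_comp_linear R (state R n m) _ _
  (fun z => submxrow z.1.1.1 i) h (theta_block_linear i) (@theta_block_continuous i) hs).
Qed.

Lemma smooth_phi_block j (h : 'rV[R]_(m j) -> R) : smooth h ->
  smooth (fun z : state R n m => h (submxrow z.1.1.2 j)).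
Proof.
move=> hs; exact: (@smooth_comp_linear R (state R n m) _ _
  (fun z => submxrow z.1.1.2 j) h (phi_block_linear j) (@phi_block_continuous j) hs).
Qed.

Lemma smooth_lambda : smooth (fun z : state R n m => z.1.2).
Proof.
apply: (@smooth_comp_linear _ _ _ _ (fun z : state R n m => z.1.2) (fun t : R => t)) => //.
  move=> z; apply: (@continuous_comp _ _ _ (fun z : state R n m => z.1) snd).
    exact: cvg_fst.
  exact: cvg_snd.
exact: smooth_id.
Qed.

Lemma smooth_mu : smooth (fun z : state R n m => z.2).
Proof.
apply: (@smooth_comp_linear _ _ _ _ (fun z : state R n m => z.2) (fun t : R => t)) => //.
  by move=> z; exact: cvg_snd.
exact: smooth_id.
Qed.

End StateBlocks.

Lemma continuous_pair (S T U : topologicalType) (a : S -> T) (b : S -> U) x :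
  {for x, continuous a} -> {for x, continuous b} ->
  {for x, continuous (fun s => (a s, b s))}.
Proof. by move=> ac bc; exact: (cvg_pair ac bc). Qed.

Lemma open_forall (T : topologicalType) (I : finType) (A : I -> set T) :
  (forall i, open (A i)) -> open [set x | forall i, A i x].
Proof.
move=> Ao; rewrite openE => x Ax; apply: filter_forall => i.
by apply: open_nbhs_nbhs; split; [exact: Ao|exact: Ax].
Qed.

(** * The invariant leaf *)

Section Reduction.
Variables (R : realType) (N M : nat) (n : 'I_N -> nat) (m : 'I_M -> nat).
Variables (f : forall i : 'I_N, 'rV[R]_(n i) -> R) (g : forall j : 'I_M, 'rV[R]_(m j) -> R).
Variables (U : 'M[R]_(N, M)) (p : 'cV[R]_N) (q : 'cV[R]_M) (val : R).
Variables (theta0 : forall i : 'I_N, 'rV[R]_(n i)) (phi0 : forall j : 'I_M, 'rV[R]_(m j)).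
Variables (lambda0 mu0 : R).
Variables (gam : forall i : 'I_N, R -> 'rV[R]_(n i)) (del : forall j : 'I_M, R -> 'rV[R]_(m j)).
Variables (sp : 'I_N -> R) (sq : 'I_M -> R).
Arguments f : clear implicits.
Arguments g : clear implicits.
Hypotheses (f_smooth : forall i, smooth (f i)) (g_smooth : forall j, smooth (g j)).
Hypotheses (gam_curve : forall i, integral_curve (grad (f i)) (theta0 i) (gam i))
  (del_curve : forall j, integral_curve (grad (g j)) (phi0 j) (del j)).
Hypotheses (f_regular : forall i, grad (f i) (theta0 i) != 0)
  (g_regular : forall j, grad (g j) (phi0 j) != 0).
Hypotheses (sp_hit : forall i, p i 0 = f i (gam i (sp i)))
  (sq_hit : forall j, q j 0 = g j (del j (sq j))).
Hypotheses (Uq : forall i, \sum_j U i j * q j 0 = val)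
  (Up : forall j, \sum_i U i j * p i 0 = val).
Hypotheses (p_sum : \sum_i p i 0 = 1) (q_sum : \sum_j q j 0 = 1).

(** The coordinates of the leaf: the clocks s_i and r_j, then lambda (true) and mu
    (false). *)
Definition index_set : finType := ('I_N + 'I_M + bool)%type.
Let k := #|index_set|.
Let I_theta (i : 'I_N) : index_set := inl (inl i).
Let I_phi (j : 'I_M) : index_set := inl (inr j).
Let I_lambda : index_set := inr true.
Let I_mu : index_set := inr false.
Let crd (x : 'rV[R]_k) (s : index_set) : R := x 0 (enum_rank s).

Let F i := f i \o gam i.
Let G j := g j \o del j.

(** The coordinate functions phi_a. At the equilibrium, lambda and mu are both
    equal to - val. *)
Definition force (s : index_set) : R -> R :=
  match s with
  | inl (inl i) => fun t => F i t - p i 0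
  | inl (inr j) => fun t => G j t - q j 0
  | inr _ => fun t => t + val
  end.

(** The antisymmetric matrix J, read off from the reduced equations: its row s
    lists the coefficients in the equation of the coordinate s. *)
Definition coupling (s s' : index_set) : R :=
  match s, s' with
  | inl (inl i), inl (inr j) => - U i j
  | inl (inr j), inl (inl i) => U i j
  | inl (inl _), inr true => - 1
  | inr true, inl (inl _) => 1
  | inl (inr _), inr false => 1
  | inr false, inl (inr _) => - 1
  | _, _ => 0
  end.

Definition coupling_mx : 'M[R]_k := \matrix_(a, b) coupling (enum_val a) (enum_val b).
Definition force_at (a : 'I_k) := force (enum_val a).
Definition reduced_field := separable_field coupling_mx force_at.

Lemma coupling_antisym a b : coupling_mx a b = - coupling_mx b a.
Proof.
by rewrite !mxE; case: (enum_val a) (enum_val b) => [[i|j]|[]] [[i'|j']|[]] /=;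
  rewrite ?opprK ?oppr0.
Qed.

Lemma reduced_fieldE x s : reduced_field x 0 (enum_rank s) =
  \sum_i coupling s (I_theta i) * (F i (crd x (I_theta i)) - p i 0) +
  \sum_j coupling s (I_phi j) * (G j (crd x (I_phi j)) - q j 0) +
  (coupling s I_lambda * (crd x I_lambda + val) + coupling s I_mu * (crd x I_mu + val)).
Proof.
rewrite mxE (reindex (@enum_rank index_set)) /=; last exact: onW_bij (enum_rank_bij _).
under eq_bigr => s' _ do rewrite mxE /force_at !enum_rankK.
by rewrite big_sumType big_sumType/= big_bool.
Qed.

(** In the four component formulas the constants p, q and val cancel out, by the
    indifference relations and the normalization of p and q. *)
Lemma reduced_theta x i : reduced_field x 0 (enum_rank (I_theta i)) =
  - (\sum_j U i j * G j (crd x (I_phi j)) + crd x I_lambda).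
Proof.
rewrite reduced_fieldE /= big1 ?add0r => [|j _]; last by rewrite mul0r.
under eq_bigr do rewrite mulNr mulrBr.
rewrite sumrN sumrB Uq; ring.
Qed.

Lemma reduced_phi x j : reduced_field x 0 (enum_rank (I_phi j)) =
  \sum_i U i j * F i (crd x (I_theta i)) + crd x I_mu.
Proof.
rewrite reduced_fieldE /= [X in _ + X + _]big1 => [|i _]; last by rewrite mul0r.
under eq_bigr do rewrite mulrBr.
rewrite sumrB Up; ring.
Qed.

Lemma reduced_lambda x : reduced_field x 0 (enum_rank I_lambda) =
  \sum_i F i (crd x (I_theta i)) - 1.
Proof.
rewrite reduced_fieldE /= [X in _ + X + _]big1 => [|i _]; last by rewrite mul0r.
under eq_bigr do rewrite mul1r.
rewrite sumrB p_sum; ring.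
Qed.

Lemma reduced_mu x : reduced_field x 0 (enum_rank I_mu) =
  - (\sum_j G j (crd x (I_phi j)) - 1).
Proof.
rewrite reduced_fieldE /= big1 => [|i _]; last by rewrite mul0r.
under eq_bigr do rewrite mulN1r.
rewrite sumrN sumrB q_sum; ring.
Qed.

Let F_smooth i : smooth (F i).
Proof. exact: ascent_value_smooth (f_smooth i) (gam_curve i). Qed.

Let G_smooth j : smooth (G j).
Proof. exact: ascent_value_smooth (g_smooth j) (del_curve j). Qed.

Let F_pos i (t : R) : 0 < 'D_1 (F i) t.
Proof. exact: ascent_speed_pos (f_smooth i) (f_regular i) (gam_curve i) t. Qed.

Let G_pos j (t : R) : 0 < 'D_1 (G j) t.
Proof. exact: ascent_speed_pos (g_smooth j) (g_regular j) (del_curve j) t. Qed.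

Lemma reduced_flow : exists Psi : R -> 'rV[R]_k -> 'rV[R]_k,
  [/\ forall x, solves reduced_field (Psi ^~ x),
      continuous (fun tx : R * 'rV[R]_k => Psi tx.1 tx.2)
    & poincare_recurrent setT Psi].
Proof.
pose c (a : 'I_k) : R := match (enum_val a : index_set) with
  | inl (inl i) => sp i | inl (inr j) => sq j | inr _ => - val end.
apply: (@separable_flow_recurrent _ _ _ _ c).
- exact: coupling_antisym.
- move=> a x y xy; rewrite /force_at; case: (enum_val a) => [[i|j]|b] /=.
  + by rewrite ltrD2r; apply: (increasing_of_deriv (F_smooth i) (F_pos i)).
  + by rewrite ltrD2r; apply: (increasing_of_deriv (G_smooth j) (G_pos j)).
  + by rewrite ltrD2r.
- move=> a; rewrite /force_at /c; case: (enum_val a) => [[i|j]|b] /=.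
  + by rewrite /F /= -sp_hit subrr.
  + by rewrite /G /= -sq_hit subrr.
  + by rewrite addNr.
move=> a r; rewrite /force_at; case: (enum_val a) => [[i|j]|b] /=.
- have [K K0 HK] := smooth_lipschitz_segment r (F_smooth i).
  exists K => // x y xr yr; have := HK x y xr yr.
  by rewrite opprB addrA subrK.
- have [K K0 HK] := smooth_lipschitz_segment r (G_smooth j).
  exists K => // x y xr yr; have := HK x y xr yr.
  by rewrite opprB addrA subrK.
- exists 1 => // x y _ _; rewrite mul1r.
  by have -> : x + val - (y + val) = x - y by ring.
Qed.

Definition leaf_param (x : 'rV[R]_k) : state R n m :=
  mkstate (fun i => gam i (crd x (I_theta i))) (fun j => del j (crd x (I_phi j)))
    (crd x I_lambda) (crd x I_mu).

(** The clock of a block is read off from the value of f_i or g_j there, which is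
    strictly monotone along the ascent curve. *)
Definition leaf_chart (z : state R n m) : 'rV[R]_k :=
  \row_a match (enum_val a : index_set) with
  | inl (inl i) => inverse (F i) (f i (submxrow z.1.1.1 i))
  | inl (inr j) => inverse (G j) (g j (submxrow z.1.1.2 j))
  | inr true => z.1.2
  | inr false => z.2
  end.

Lemma leaf_paramK : cancel leaf_param leaf_chart.
Proof.
move=> x; apply/rowP => a; rewrite mxE -[in RHS](enum_valK a).
case: (enum_val a) => [[i|j]|[]] //=; rewrite mxrowK.
- exact: (inverseK (F_smooth i) (F_pos i)).
- exact: (inverseK (G_smooth j) (G_pos j)).
Qed.

Let theta_idx (l : 'I_(\sum_i n i)) := I_theta (tagnat.sig1 l : 'I_N).
Let phi_idx (l : 'I_(\sum_j m j)) := I_phi (tagnat.sig1 l : 'I_M).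

Lemma leaf_paramE x : leaf_param x =
  \sum_l gam (tagnat.sig1 l) (crd x (theta_idx l)) 0 (tagnat.sig2 l) *: theta_basis R m l +
  \sum_l del (tagnat.sig1 l) (crd x (phi_idx l)) 0 (tagnat.sig2 l) *: phi_basis R n l +
  crd x I_lambda *: lambda_basis R n m + crd x I_mu *: mu_basis R n m.
Proof. exact: mkstate_sum. Qed.

Let crd_comp_Ck (h : R -> R) s k' : smooth h -> Ck_on k' setT (fun x => h (crd x s)).
Proof. by move=> hs; exact: (@smooth_comp_coord R k h (enum_rank s) hs k'). Qed.

Lemma leaf_param_smooth : smooth leaf_param.
Proof.
move=> k'; rewrite (funext leaf_paramE).
apply: (Ck_on_add openT); [apply: (Ck_on_add openT); [apply: (Ck_on_add openT)|]|].
- apply: (Ck_on_sum openT) => l; apply: (Ck_onZl openT).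
  apply: (crd_comp_Ck (h := fun t => gam (tagnat.sig1 l) t 0 (tagnat.sig2 l))).
  exact: ascent_coord_smooth (f_smooth _) (gam_curve _) _.
- apply: (Ck_on_sum openT) => l; apply: (Ck_onZl openT).
  apply: (crd_comp_Ck (h := fun t => del (tagnat.sig1 l) t 0 (tagnat.sig2 l))).
  exact: ascent_coord_smooth (g_smooth _) (del_curve _) _.
- by apply: (Ck_onZl openT); exact: (crd_comp_Ck (h := fun t => t) _ _ (@smooth_id R R)).
- by apply: (Ck_onZl openT); exact: (crd_comp_Ck (h := fun t => t) _ _ (@smooth_id R R)).
Qed.

(** On the leaf, each block of the field is tangent to the corresponding ascent
    curve, with the component of the reduced field as its factor. *)
Lemma gda_field_leaf x : gda_field f g U (leaf_param x) =
  mkstate (fun i => reduced_field x 0 (enum_rank (I_theta i)) *: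
             grad (f i) (gam i (crd x (I_theta i))))
          (fun j => reduced_field x 0 (enum_rank (I_phi j)) *:
             grad (g j) (del j (crd x (I_phi j))))
          (reduced_field x 0 (enum_rank I_lambda))
          (reduced_field x 0 (enum_rank I_mu)).
Proof.
have gE : (fun j => g j (submxrow (\mxrow_j del j (crd x (I_phi j))) j)) =
   (fun j => G j (crd x (I_phi j))) by apply/funext => j; rewrite mxrowK.
have fE : (fun i => f i (submxrow (\mxrow_i gam i (crd x (I_theta i))) i)) =
   (fun i => F i (crd x (I_theta i))) by apply/funext => i; rewrite mxrowK.
have gE' j := congr1 (fun h => h j) gE; have fE' i := congr1 (fun h => h i) fE.
rewrite reduced_lambda reduced_mu /gda_field /leaf_param {2 3}/mkstate.
congr (mkstate _ _ _ _).
- apply: functional_extensionality_dep => i; rewrite reduced_theta mxrowK scaleNr.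
  by under eq_bigr do rewrite gE'.
- apply: functional_extensionality_dep => j; rewrite reduced_phi mxrowK.
  by under eq_bigr do rewrite fE'.
- by under eq_bigr do rewrite fE'.
- by under eq_bigr do rewrite gE'.
Qed.

Lemma leaf_param_derive c (t : R) : solves reduced_field c ->
  is_derive t 1 (fun s => leaf_param (c s)) (gda_field f g U (leaf_param (c t))).
Proof.
move=> cs; rewrite gda_field_leaf mkstate_sum.
rewrite (funext (fun s => leaf_paramE (c s))).
apply: is_derive_add; [apply: is_derive_add; [apply: is_derive_add|]|].
- apply: is_derive_bigsum => l; apply: is_derive_scalel.
  rewrite mxE mulrC.
  apply: (@is_derive1_comp R (fun u => gam _ u 0 _) (fun s => c s 0 _)); last exact: cs.
  by apply: is_derive_entry; case: (gam_curve (tagnat.sig1 l)).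
- apply: is_derive_bigsum => l; apply: is_derive_scalel.
  rewrite mxE mulrC.
  apply: (@is_derive1_comp R (fun u => del _ u 0 _) (fun s => c s 0 _)); last exact: cs.
  by apply: is_derive_entry; case: (del_curve (tagnat.sig1 l)).
- by apply: is_derive_scalel; exact: cs.
- by apply: is_derive_scalel; exact: cs.
Qed.

(** The open set of all states, on the leaf or not, at which the chart formula
    makes sense; smoothness on the leaf is smoothness near it in the ambient
    space. *)
Definition chart_domain : set (state R n m) := [set z |
  (forall i, range (F i) (f i (submxrow z.1.1.1 i))) /\
  (forall j, range (G j) (g j (submxrow z.1.1.2 j)))].

Lemma chart_domain_open : open chart_domain.
Proof.
apply: openI; apply: open_forall => i; apply: open_comp.
- move=> z _; exact: (smooth_continuous (@smooth_theta_block R N M n m i (f i) (f_smooth i))).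
- exact: (range_increasing_open (F_smooth i) (F_pos i)).
- move=> z _; exact: (smooth_continuous (@smooth_phi_block R N M n m i (g i) (g_smooth i))).
- exact: (range_increasing_open (G_smooth i) (G_pos i)).
Qed.

Lemma leaf_param_domain x : chart_domain (leaf_param x).
Proof.
by split=> [i|j]; rewrite mxrowK; [exists (crd x (I_theta i))|exists (crd x (I_phi j))].
Qed.

Lemma leaf_chart_Ck k' : Ck_on k' chart_domain leaf_chart.
Proof.
rewrite (_ : leaf_chart = (fun z => \sum_a leaf_chart z 0 a *: delta_mx 0 a)); last first.
  by apply/funext => z; exact: row_sum_delta.
apply: (Ck_on_sum chart_domain_open) => a; apply: (Ck_onZl chart_domain_open).
under [X in Ck_on _ _ X]eq_fun do rewrite mxE.
case: (enum_val a) => [[i|j]|[]] /=.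
- have H := @inverse_comp_Ck _ _ (F_smooth i) (F_pos i) _ _ k'
    (@smooth_theta_block R N M n m i (f i) (f_smooth i)).
  by apply: (Ck_on_subset _ H) => z [zF _]; exact: zF.
- have H := @inverse_comp_Ck _ _ (G_smooth j) (G_pos j) _ _ k'
    (@smooth_phi_block R N M n m j (g j) (g_smooth j)).
  by apply: (Ck_on_subset _ H) => z [_ zG]; exact: zG.
- exact: (Ck_on_subset (@subsetT _ _) (@smooth_lambda R N M n m k')).
- exact: (Ck_on_subset (@subsetT _ _) (@smooth_mu R N M n m k')).
Qed.

Definition leaf := range leaf_param.

Lemma leaf_diffeomorphism : diffeomorphism leaf setT leaf_chart.
Proof.
split.
  move=> _ [x _ <-]; exists chart_domain, leaf_chart; split=> //.
    by split; [exact: chart_domain_open|exact: leaf_param_domain].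
  exact: leaf_chart_Ck.
split=> //; exists leaf_param; split.
- move=> x _; exists setT, leaf_param; split=> //; first by split=> //; exact: openT.
  by move=> k'; exact: leaf_param_smooth.
- by move=> x _; exists x.
- by move=> _ /[!inE] -[x _ <-]; rewrite leaf_paramK.
- by move=> x _; exact: leaf_paramK.
Qed.

Lemma leaf_submanifold : smooth_submanifold k leaf.
Proof.
move=> z _; exists setT, setT, leaf_chart; rewrite setIT.
by split; [split; [exact: openT|]|exact: openT|exact: leaf_diffeomorphism].
Qed.

(** The ascent curves start at the initial blocks, so the clocks are 0 there. *)
Lemma leaf_start : leaf (mkstate theta0 phi0 lambda0 mu0).
Proof.
pose x : 'rV[R]_k := \row_a match (enum_val a : index_set) with
  | inl _ => 0 | inr true => lambda0 | inr false => mu0 end.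
have xE s : crd x s = match s with inl _ => 0 | inr true => lambda0 | inr false => mu0 end.
  by rewrite /crd mxE enum_rankK.
exists x => //; rewrite /leaf_param !xE/=; congr (mkstate _ _ _ _).
  by apply: functional_extensionality_dep => i; rewrite xE; case: (gam_curve i).
by apply: functional_extensionality_dep => j; rewrite xE; case: (del_curve j).
Qed.

(** The flow on the leaf is transported from R^k by the parametrization, which
    carries solutions of the reduced system to solutions of the full one. *)
Theorem leaf_trajectory : trajectory_diffeo_recurrent (gda_field f g U)
  (mkstate theta0 phi0 lambda0 mu0).
Proof.
have [Psi [Psi_solves Psi_cont Psi_rec]] := reduced_flow.
have [[_ Psi0 PsiD _] _ _] := Psi_rec.
pose Phi t z := leaf_param (Psi t (leaf_chart z)).
exists k, leaf, Phi, setT, Psi, leaf_chart; split.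
- by split; [exact: leaf_submanifold|exact: leaf_start].
- split; last first.
    move=> _ [x _ <-]; split; first by rewrite /Phi leaf_paramK Psi0.
    move=> t; rewrite /Phi leaf_paramK.
    exact: leaf_param_derive (Psi_solves x).
  split.
  + by move=> t _ [x _ <-]; exists (Psi t x); rewrite // /Phi leaf_paramK.
  + by move=> _ [x _ <-]; rewrite /Phi leaf_paramK Psi0.
  + by move=> s t _ [x _ <-]; rewrite /Phi !leaf_paramK PsiD.
  apply: continuous_in_subspaceT => -[t z] /[!inE] -[_ /= [x _ xz]].
  apply: (@continuous_comp _ _ _ (fun tz : R * state R n m => Psi tz.1 (leaf_chart tz.2)) leaf_param);
    last exact: smooth_continuous leaf_param_smooth _.
  apply: (@continuous_comp _ _ _ (fun tz : R * state R n m => (tz.1, leaf_chart tz.2))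
    (fun tx => Psi tx.1 tx.2)); last exact: Psi_cont.
  apply: continuous_pair; first exact: cvg_fst.
  apply: (@continuous_comp _ _ _ (fun tz : R * state R n m => tz.2) leaf_chart); first exact: cvg_snd.
  by apply: (@leaf_chart_Ck 0); rewrite /= -xz; exact: leaf_param_domain.
- by split=> //; exact: openT.
- exact: leaf_diffeomorphism.
- by move=> _ t [x _ <-]; rewrite /Phi !leaf_paramK.
Qed.

End Reduction.

Theorem theorem6 (R : realType) (N M : nat) (n : 'I_N -> nat) (m : 'I_M -> nat)
    (f : forall i : 'I_N, 'rV[R]_(n i) -> R)
    (g : forall j : 'I_M, 'rV[R]_(m j) -> R)
    (U : 'M[R]_(N, M)) (p : 'cV[R]_N) (q : 'cV[R]_M)
    (theta0 : forall i : 'I_N, 'rV[R]_(n i))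
    (phi0 : forall j : 'I_M, 'rV[R]_(m j)) (lambda0 mu0 : R)
    (f_ge0 : forall i x, 0 <= f i x) (g_ge0 : forall j x, 0 <= g j x)
    (f_smooth : forall i, smooth (f i)) (g_smooth : forall j, smooth (g j))
    (f_complete : forall i, complete_gradient_flow (f i))
    (g_complete : forall j, complete_gradient_flow (g j))
    (nash : fully_mixed_nash U p q)
    (safe : safe_initialization f g p q theta0 phi0) :
  trajectory_diffeo_recurrent (gda_field f g U)
    (mkstate theta0 phi0 lambda0 mu0).
Proof.
have [[[_ p_sum] _] [[_ q_sum] _] _ _] := nash.
have [val [Uq Up]] := fully_mixed_nash_indifferent nash.
have [f_regular g_regular p_hit q_hit] := safe.
pose gam i := projT1 (cid2 (p_hit i)).
pose del j := projT1 (cid2 (q_hit j)).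
have gam_curve i : integral_curve (grad (f i)) (theta0 i) (gam i).
  by rewrite /gam; case: (cid2 _).
have del_curve j : integral_curve (grad (g j)) (phi0 j) (del j).
  by rewrite /del; case: (cid2 _).
have gam_hit i : exists s, p i 0 = f i (gam i s) by rewrite /gam; case: (cid2 _).
have del_hit j : exists s, q j 0 = g j (del j s) by rewrite /del; case: (cid2 _).
exact: (@leaf_trajectory R N M n m f g U p q val theta0 phi0 lambda0 mu0 gam del
  (fun i => projT1 (cid (gam_hit i))) (fun j => projT1 (cid (del_hit j)))
  f_smooth g_smooth gam_curve del_curve f_regular g_regular
  (fun i => projT2 (cid (gam_hit i))) (fun j => projT2 (cid (del_hit j)))
  Uq Up p_sum q_sum).
Qed.
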